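(* There is an absolute constant $C>0$ such that the following holds. Let $p$ be a prime and let $\mathcal{G}$ be a multiplicative subgroup of $\mathbb{F}_p^*$. Then for any $\lambda\in\mathbb{F}_p^*$, $$ \left|\mathrm{T}_\lambda(\mathcal{G})-\frac{|\mathcal{G}|^6}{p}\right|\le C\cdot \begin{cases} p^{1/2}|\mathcal{G}|^{7/2}, & \text{if } |\mathcal{G}|\ge p^{2/3},\\ |\mathcal{G}|^5p^{-1/2}, & \text{if } p^{2/3}>|\mathcal{G}|\ge p^{1/2}\log p,\\ |\mathcal{G}|^4\log|\mathcal{G}|, & \text{if } |\mathcal{G}|<p^{1/2}\log p. \end{cases} $$
   Context: $\mathbb{F}_p$ is the finite field with $p$ elements and $\mathbb{F}_p^*$ its multiplicative group. For sets $\mathcal{U}_1,\mathcal{U}_2\subseteq\mathbb{F}_p^*$ and $\lambda_1,\lambda_2\in\mathbb{F}_p^*$, $\mathrm{T}_{\lambda_1,\lambda_2}(\mathcal{U}_1,\mathcal{U}_2)$ denotes the number of solutions to $$ \frac{u_1-\lambda_1v_1}{u_1-\lambda_1w_1}=\frac{u_2-\lambda_2v_2}{u_2-\lambda_2w_2},\qquad u_i,v_i,w_i\in\mathcal{U}_i,\ i=1,2, $$ where only those values of the variables are considered for which both sides are defined, that is, $u_i\ne\lambda_iw_i$ for $i=1,2$. For a multiplicative subgroup $\mathcal{G}$ of $\mathbb{F}_p^*$ put $\mathrm{T}_\lambda(\mathcal{G})=\mathrm{T}_{1,\lambda}(\mathcal{G},\mathcal{G})$. $\log$ is the natural logarithm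.
   Formalization: In the third case the subgroup is assumed to have more than one element, since for the trivial subgroup and p ≥ 3 the bound is false: the count is 0, the left side is 1/p > 0, and log|G| = 0. *)

(* Defs.v *)
From HB Require Import structures.
From mathcomp Require Import all_boot all_order all_algebra all_fingroup.
From mathcomp Require Import all_classical all_reals all_analysis.

Set Implicit Arguments.
Unset Strict Implicit.
Unset Printing Implicit Defensive.

Import Order.TTheory GRing.Theory Num.Theory.
Local Open Scope ring_scope.

(* F_p^* is the finite group {unit 'F_p}, which coerces to 'F_p by val; the
   definitions are meaningful for prime p only. Since x / 0 = 0 in MathComp,
   the condition that both sides be defined is stated explicitly. *)
Definition Tcount (p : nat) (lambda1 lambda2 : {unit 'F_p})
    (U1 U2 : {set {unit 'F_p}}) : nat :=
  #|[set x : ({unit 'F_p} * {unit 'F_p} * {unit 'F_p}) *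
             ({unit 'F_p} * {unit 'F_p} * {unit 'F_p}) |
     let: ((u1, v1, w1), (u2, v2, w2)) := x in
     [&& [&& u1 \in U1, v1 \in U1 & w1 \in U1],
         [&& u2 \in U2, v2 \in U2 & w2 \in U2],
         val u1 != val lambda1 * val w1,
         val u2 != val lambda2 * val w2 &
         (val u1 - val lambda1 * val v1) / (val u1 - val lambda1 * val w1)
         == (val u2 - val lambda2 * val v2) / (val u2 - val lambda2 * val w2)]]|.

Definition Tsubgroup (p : nat) (lambda : {unit 'F_p})
    (G : {group {unit 'F_p}}) : nat :=
  Tcount 1%g lambda G G.

(* Main.v *)
Require Import Defs.
From HB Require Import structures.
From mathcomp Require Import all_boot all_order all_algebra all_fingroup.
From mathcomp Require Import cyclic finfield.
From mathcomp Require Import all_classical all_reals all_analysis.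
From mathcomp Require Import ring lra zify.

(** A solution counted by T is a triple of points (u1, u2), (v1, lambda v2),
    (w1, lambda w2), the first in G x G and the others in G x lambda G, that
    lie on one line.  Up to O(n^4) degenerate triples, n = |G|, the line is
    alpha x + beta y = 1 with alpha, beta nonzero, so T is the sum over all
    lines l of N(l) N'(l) (N'(l) - 1), where N(l) is the number of points of
    G x G on l and N'(l) = N(l'), l' being l with beta replaced by
    beta lambda (sum_triples_le, Tset_le_sum_triples).

    The first two moments of N over the lines are elementary: the mean is close
    to mu = n^2 / p and the sum of (N - mu)^2 is at most 4 n^2 p (variance_le).
    Expanding the cubic sum around mu gives n^6 / p as main term, with an error
    O(n^4) plus the sum of |N - mu|^3 (third_moment).  That sum is bounded in
    two ways.

    - For n >= p^(2/3): N is constant on orbits of G x G on the lines, and an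
      orbit has n^2 elements, so one deviation squared, taken n^2 times, is at
      most the variance.  Hence |N - mu| <= 2 sqrt p, and the third moment is
      O(p^(3/2) n^2), without character sums (third_deviation_orbit).

    - For n < p^(2/3): lines with N = O(mu + 1) contribute O(mu + 1) times the
      variance.  For the others Stepanov's method, applied to all rich orbits
      simultaneously, shows that at most O(n^4 / tau^3) lines have N >= tau
      (level_set_bound).  Summing over tau gives O(n^4 log n), the logarithm
      being a harmonic sum (tail_third_moment).

    For Stepanov's method, put t = alpha x on the line: t^n = alpha^n and
    (1 - t)^n = beta^n, so the points on lines from M orbits inject into the
    set of t whose pair (t^n, (1 - t)^n) lies in a set Q of M pairs.  A nonzero
    polynomial that is a combination of X^(n b) (1 - X)^(n c) with coefficients
    of degree < A, for b, c < B, is made to vanish to order A at all those t;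
    its degree is at most A + 2 n B, which bounds their number (stepanov).

    The estimate O(n^4 (1 + log n)) thus covers n < p^(2/3), where it is
    stronger than the middle bound of the theorem, since there log p is at most
    n / sqrt p.  For small p the third case also meets n >= p^(2/3);
    overlap_case handles this. *)

Set Implicit Arguments.
Unset Strict Implicit.
Unset Printing Implicit Defensive.

Import Order.TTheory GRing.Theory Num.Theory.
Local Open Scope ring_scope.

(** * Sparse polynomials over a prime field *)

Lemma Fp_natr_neq0 (p m : nat) : prime p -> (0 < m < p)%N -> m%:R != 0 :> 'F_p.
Proof.
move=> pp /andP[m0 mp].
by rewrite -(dvdn_pcharf (pchar_Fp pp)) gtnNdvd.
Qed.

Lemma Fp_natr_inj (p i m : nat) :
  prime p -> (i < p)%N -> (m < p)%N -> i%:R = m%:R :> 'F_p -> i = m.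
Proof.
move=> pp ip mp; wlog im : i m ip mp / (m <= i)%N => [H|] e.
  by case: (leqP m i) => [|/ltnW] mi; [apply: H|symmetry; apply: H].
apply/eqP; apply: contraT => ne.
have lt : (0 < i - m < p)%N by lia.
by have := Fp_natr_neq0 pp lt; rewrite natrB // e subrr eqxx.
Qed.

Lemma dvdp_deriv_exp (F : fieldType) (a : F) k (f : {poly F}) :
  ('X - a%:P) ^+ k.+1 %| f -> ('X - a%:P) ^+ k %| f^`().
Proof.
case/dvdpP => h ->; rewrite derivM deriv_exp derivXsubC mul1r /=.
apply: dvdp_add; first by rewrite exprS mulrA dvdp_mull.
by rewrite dvdp_mull // -mulr_natr dvdp_mulr.
Qed.

(** A polynomial of degree < p with k monomials cannot have a k-fold root at 1.
    For an exponent m of f, the operator X f' - m f kills the monomial X^m,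
    keeps the others up to nonzero scalars because exponents are distinct
    modulo p, and lowers the multiplicity of the root by at most one.
    The hypothesis n B <= p of Stepanov's bound comes from here. *)
Lemma sparse_poly_eq0 (p : nat) (s : seq nat) (f : {poly 'F_p}) :
  prime p -> {in s, forall i, i < p}%N -> (forall i, f`_i != 0 -> i \in s) ->
  ('X - 1%:P) ^+ size s %| f -> f = 0.
Proof.
move=> pp; elim: s f => [|m s IH] f sp supp /= dvd.
  by apply/polyP=> i; rewrite coef0; apply/eqP/contraT => /supp.
pose g := 'X * f^`() - f *+ m.
have coefg i : g`_i = f`_i * (i%:R - m%:R).
  rewrite coefB coefXM coefMn coef_deriv.
  case: i => [|i] /=; first by rewrite !sub0r mulrN mulr_natr.
  by rewrite mulrBr !mulr_natr.
have g0 : g = 0.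
  apply: IH => [i si|i|]; first by apply: sp; rewrite inE si orbT.
    rewrite coefg; case: (eqVneq i m) => [->|im]; first by rewrite subrr mulr0 eqxx.
    have [->|fi _] := eqVneq f`_i 0; first by rewrite mul0r eqxx.
    by have := supp _ fi; rewrite inE (negPf im).
  rewrite dvdp_sub // ?dvdp_mull ?dvdp_deriv_exp //.
  by rewrite -mulr_natr dvdp_mulr // (dvdp_trans _ dvd) // dvdp_exp2l.
have mp : (m < p)%N by apply: sp; rewrite inE eqxx.
have fE : f = f`_m *: 'X^m.
  apply/polyP => i; rewrite coefZ coefXn.
  case: (eqVneq i m) => [->|im]; first by rewrite mulr1.
  rewrite mulr0; apply/eqP/contraT => fi; move/eqP: (coefg i).
  rewrite g0 coef0 eq_sym mulf_eq0 (negPf fi) subr_eq0 /= => /eqP e.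
  by move: im; rewrite (Fp_natr_inj pp _ mp e) ?eqxx //; apply/sp/supp.
have : root f 1.
  by rewrite -dvdp_XsubCl (dvdp_trans _ dvd) // exprS dvdp_mulr.
rewrite rootE fE hornerZ hornerXn expr1n mulr1 => /eqP ->.
by rewrite scale0r.
Qed.

(** * Multiplicities through the derivation x(1 - x) d/dx *)

(** The derivation x(1 - x) d/dx. Unlike d/dx it preserves the shape
    X^m (1 - X)^l f, raising the degree of f by one only, and away from 0 and 1
    it detects multiplicities as well as d/dx does. *)
Definition xderiv (R : comNzRingType) (f : {poly R}) : {poly R} :=
  'X * (1 - 'X) * f^`().

(** Writing f = (X - t)^D h, the only term of xderiv f not divisible by (X - t)^D
    carries the factor D t (1 - t), which is invertible when
    0 < D < p and t is neither 0 nor 1; so h vanishes at t. *)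
Lemma xderiv_dvdp (p D : nat) (t : 'F_p) (f : {poly 'F_p}) :
  prime p -> (D <= p)%N -> t != 0 -> t != 1 ->
  (forall k, (k < D)%N -> (iter k (@xderiv _) f).[t] = 0) ->
  ('X - t%:P) ^+ D %| f.
Proof.
move=> pp + t0 t1; elim: D f => [|D IH] f Dp van; first by rewrite expr0 dvd1p.
have dv : ('X - t%:P) ^+ D %| f by apply: IH => [|k kD]; [lia|apply: van; lia].
have : ('X - t%:P) ^+ D %| xderiv f.
  by apply: IH => [|k kD]; [lia|rewrite -iterSr; apply: van; lia].
case: D {IH} Dp van dv => [|D] Dp van dv.
  by move=> _; rewrite expr1 dvdp_XsubCl rootE; apply/eqP/(van 0).
case/dvdpP: (dv) => h fE.
rewrite /xderiv fE derivM mulrDr mulrA dvdp_addr; last by rewrite dvdp_mull.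
have XN0 : ('X - t%:P) ^+ D != 0 by rewrite expf_neq0 ?polyXsubC_eq0.
rewrite deriv_exp derivXsubC mul1r /= -mulr_natr exprS !mulrA mulrAC.
rewrite dvdp_mul2r // dvdp_XsubCl !rootM.
rewrite rootX (negPf t0) -opprB rootN -[1]/(1%:P) root_XsubC (negPf t1) /=.
case/orP => [|hD].
  by rewrite -dvdp_XsubCl => hd; rewrite -mulrA -exprS [_ ^+ D.+2]exprS dvdp_mul.
have /negP[] : D.+1%:R != 0 :> 'F_p by apply: Fp_natr_neq0.
by move: hD; rewrite rootE -polyC_natr hornerC.
Qed.

(** The operator induced by xderiv on the cofactor of X^m (1 - X)^l. *)
Definition twist (R : comNzRingType) (m l : nat) (f : {poly R}) : {poly R} :=
  xderiv f + ((1 - 'X) *+ m - 'X *+ l) * f.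

Lemma xderiv_twist (R : comNzRingType) m l (f : {poly R}) :
  xderiv ('X^m * (1 - 'X) ^+ l * f) = 'X^m * (1 - 'X) ^+ l * twist m l f.
Proof.
have dX : 'X * ('X^m)^`() = 'X^m *+ m :> {poly R}.
  by rewrite derivXn; case: m => [|m]; rewrite ?mulr0n ?mulr0 // mulrnAr -exprS.
have d1X : (1 - 'X) * ((1 - 'X) ^+ l)^`() = - ((1 - 'X) ^+ l *+ l) :> {poly R}.
  rewrite deriv_exp derivB derivX -[1]/(1%:P) derivC.
  by case: l => [|l]; rewrite ?mulr0n ?mulr0 ?oppr0 //= exprS; ring.
rewrite /twist /xderiv !derivM.
transitivity ((1 - 'X) * ('X * ('X^m)^`()) * (1 - 'X) ^+ l * f
   + 'X * 'X^m * ((1 - 'X) * ((1 - 'X) ^+ l)^`()) * f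
   + 'X^m * (1 - 'X) ^+ l * ('X * (1 - 'X) * f^`())); first by ring.
by rewrite dX d1X; ring.
Qed.

Lemma iter_xderiv_twist (R : comNzRingType) k m l (f : {poly R}) :
  iter k (@xderiv _) ('X^m * (1 - 'X) ^+ l * f)
  = 'X^m * (1 - 'X) ^+ l * iter k (twist m l) f.
Proof. by elim: k => //= k ->; rewrite xderiv_twist. Qed.

Lemma xderivD (R : comNzRingType) (f g : {poly R}) :
  xderiv (f + g) = xderiv f + xderiv g.
Proof. by rewrite /xderiv derivD mulrDr. Qed.

Lemma iter_xderiv_sum (R : comNzRingType) (I : finType) k (f : I -> {poly R}) :
  iter k (@xderiv _) (\sum_i f i) = \sum_i iter k (@xderiv _) (f i).
Proof.
elim: k => //= k ->.
apply: (big_morph (@xderiv R) (@xderivD R)).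
by rewrite /xderiv raddf0 mulr0.
Qed.

Lemma iter_twistB (R : comNzRingType) k m l (f g : {poly R}) :
  iter k (twist m l) (f - g) = iter k (twist m l) f - iter k (twist m l) g.
Proof.
by elim: k => //= k ->; rewrite /twist /xderiv derivB; ring.
Qed.

Lemma size_iter_twist (R : comNzRingType) k m l (f : {poly R}) :
  (size (iter k (twist m l) f) <= size f + k)%N.
Proof.
elim: k => [|k IH]; first by rewrite addn0.
rewrite iterS addnS; set g := iter k _ f in IH *.
have s1X : (size (1 - 'X : {poly R})%R <= 2)%N.
  by rewrite -opprB size_polyN -[1]/(1%:P) size_XsubC.
have sX : (size ('X : {poly R})%R <= 2)%N by rewrite size_polyX.
have sL : (size ((1 - 'X : {poly R}) *+ m - 'X *+ l)%R <= 2)%N.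
  apply/leq_sizeP => -[|[|j]] // _.
  by rewrite coefB !coefMn coefB coef1 coefX /= subrr !mul0rn subrr.
rewrite (leq_trans (size_polyD _ _)) // geq_max; apply/andP; split; last first.
  apply: leq_trans (size_polyMleq _ _) _.
  by move: sL IH; move: (size _) (size _) (size _) => x y z; lia.
rewrite /xderiv; have [->|g0] := eqVneq g 0; first by rewrite raddf0 mulr0 size_poly0.
apply: leq_trans (size_polyMleq _ _) _.
have := size_polyMleq ('X : {poly R}) (1 - 'X); have := lt_size_deriv g0.
by move: sX s1X IH; do 6!move: (size _) => ?; lia.
Qed.

(** * The auxiliary polynomial of Stepanov's method *)

(** Linear independence of the powers u^(n c) over cofactors that u^n cannot
    divide unless they vanish: the lowest cofactor is divisible by u^n, hence
    is 0, and one factor u^n cancels from the rest. *)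
Lemma sum_exp_eq0 (F : fieldType) (u : {poly F}) B (P : nat -> {poly F}) n :
  u != 0 -> (forall c, (c < B)%N -> u ^+ n %| P c -> P c = 0) ->
  \sum_(c < B) u ^+ (n * c) * P c = 0 -> forall c, (c < B)%N -> P c = 0.
Proof.
move=> u0; elim: B P => [|B IH] P div S0 //.
move: S0; rewrite big_ord_recl muln0 expr0 mul1r.
under eq_bigr => i _ do rewrite lift0 mulnS exprD -mulrA.
rewrite -mulr_sumr => S0.
have P0 : P 0%N = 0.
  apply: div => //; rewrite -(dvdp_addl _
    (n := u ^+ n * \sum_(i < B) u ^+ (n * i) * P i.+1)).
    by rewrite S0 dvdp0.
  by rewrite dvdp_mulr.
case=> [//|c] cB; apply: (IH (fun c => P c.+1)) => //.
  by move=> d dB; apply: div.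
move/eqP: S0; rewrite P0 add0r mulf_eq0 expf_eq0 (negPf u0) andbF /=.
by move/eqP.
Qed.

Lemma coef_sum_Xn (R : nzRingType) A B n (f : 'I_B -> {poly R}) i :
  (\sum_(b < B) 'X^(n * b) * f b)`_i != 0 -> (forall b, size (f b) <= A)%N ->
  exists b : 'I_B, exists2 a, (a < A)%N & i = (n * b + a)%N.
Proof.
move=> + sf; rewrite coef_sum => nz.
have [b] : exists b : 'I_B, ('X^(n * b) * f b)`_i != 0.
  apply/existsP; apply: contraNT nz => /existsPn h.
  by apply/eqP/big1 => b _; apply/eqP/negbNE/h.
rewrite coefXnM; case: ltnP => [_|le nzb]; first by rewrite eqxx.
exists b; exists (i - n * b)%N; last by rewrite subnKC.
apply: leq_trans (sf b); rewrite ltnNge; apply: contraNN nzb => h.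
by rewrite nth_default.
Qed.

Lemma sum_Xn_eq0 (R : nzRingType) A B n (f : 'I_B -> {poly R}) :
  (A <= n)%N -> (forall b, size (f b) <= A)%N ->
  \sum_(b < B) 'X^(n * b) * f b = 0 -> forall b, f b = 0.
Proof.
move=> An sf S0 b; apply/polyP => a; rewrite coef0.
have [aA|Aa] := ltnP a A; last by rewrite nth_default // (leq_trans (sf b)).
have := congr1 (fun P : {poly R} => P`_(n * b + a)) S0.
rewrite coef0 coef_sum (bigD1 b) //= big1 ?addr0.
  by rewrite coefXnM ltnNge leq_addr /= addKn.
move=> b' nb; rewrite coefXnM; case: ltnP => // le.
rewrite nth_default // (leq_trans (sf b')) //.
have : b' != b :> nat by [].
rewrite neq_ltn => /orP[lt|lt].
  by have := leq_mul (leqnn n) lt; rewrite mulnS; lia.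
by have := leq_mul (leqnn n) lt; rewrite mulnS; lia.
Qed.

(** Stepanov's auxiliary polynomial, with cofactors f indexed by (b, c). *)
Definition aux_poly (F : fieldType) (n B : nat) (f : 'I_B * 'I_B -> {poly F}) :
    {poly F} :=
  \sum_(i : 'I_B * 'I_B) 'X^(n * i.1) * (1 - 'X) ^+ (n * i.2) * f i.

(** The polynomial that agrees with the k-th xderiv of aux_poly at every t such
    that (t^n, (1 - t)^n) = q: there the powers X^(n b) and (1 - X)^(n c) are
    the constants q.1^b and q.2^c. *)
Definition aux_xderiv (F : fieldType) (n B : nat) (f : 'I_B * 'I_B -> {poly F})
    (q : F * F) (k : nat) : {poly F} :=
  \sum_(i : 'I_B * 'I_B) (q.1 ^+ i.1 * q.2 ^+ i.2)
    *: iter k (twist (n * i.1) (n * i.2)) (f i).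

Lemma iter_xderiv_aux (F : fieldType) n B (f : 'I_B * 'I_B -> {poly F}) k t :
  (iter k (@xderiv _) (aux_poly n f)).[t]
  = (aux_xderiv n f (t ^+ n, (1 - t) ^+ n) k).[t].
Proof.
rewrite iter_xderiv_sum !horner_sum; apply: eq_bigr => i _.
rewrite iter_xderiv_twist hornerZ !hornerM hornerXn horner_exp hornerD hornerN.
by rewrite hornerX hornerC !exprM.
Qed.

(** As A <= n, each cofactor of (1 - X)^(n c) has at most A B <= n monomials
    and degree < p, so sparse_poly_eq0 forbids it to be divisible by (1 - X)^n,
    and sum_exp_eq0 applies; the same inequality keeps the blocks X^(n b) f
    from overlapping. *)
Lemma aux_poly_eq0 (p n A B : nat) (f : 'I_B * 'I_B -> {poly 'F_p}) :
  prime p -> (A * B <= n)%N -> (n * B <= p)%N ->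
  (forall i, size (f i) <= A)%N -> aux_poly n f = 0 -> forall i, f i = 0.
Proof.
move=> pp ABn nBp sf; rewrite /aux_poly.
case: B f ABn nBp sf => [|B] f ABn nBp sf; first by move=> _ [[]].
have An : (A <= n)%N by apply: leq_trans ABn; rewrite leq_pmulr.
pose P c := \sum_(b < B.+1) 'X^(n * b) * f (b, inord c).
move=> S0 [b c].
suff Pc0 : P c = 0.
  have := sum_Xn_eq0 (f := fun b => f (b, inord c)) An (fun b => sf _) Pc0.
  by move/(_ b); rewrite inord_val.
apply: (@sum_exp_eq0 _ (1 - 'X) B.+1 P n) => //.
- by rewrite -opprB oppr_eq0 -[1]/(1%:P) polyXsubC_eq0.
- move=> {}c _ dvd.
  pose s := [seq n * b + a | b <- iota 0 B.+1, a <- iota 0 A]%N.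
  apply: (@sparse_poly_eq0 p s) => //.
  + move=> i /allpairsP[[b' a]]; rewrite !mem_iota !add0n /=.
    case=> b'B aA ->; apply: leq_trans nBp.
    by have := leq_mul (leqnn n) b'B; rewrite mulnS; lia.
  + move=> i nz.
    have [b' [a aA ->]] := coef_sum_Xn nz (fun b => sf _).
    by apply/allpairsP; exists (nat_of_ord b', a); rewrite !mem_iota !add0n aA ltn_ord.
  + rewrite size_allpairs !size_iota.
    apply: (@dvdp_trans _ (('X - 1%:P) ^+ n)).
      by rewrite dvdp_exp2l // mulnC.
    by move: dvd; rewrite -opprB exprNn -signr_odd -[1]/(1%:P); case: odd;
       rewrite ?expr0 ?mul1r ?expr1 ?mulN1r ?dvdpNl.
rewrite -[RHS]S0 (eq_bigr (fun c : 'I_B.+1 => \sum_(b < B.+1)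
  'X^(n * b) * (1 - 'X) ^+ (n * c) * f (b, c))); last first.
  move=> d _; rewrite mulr_sumr; apply: eq_bigr => e _.
  by rewrite inord_val; ring.
rewrite exchange_big pair_bigA /=.
by apply: eq_bigr => -[].
Qed.

Lemma size_aux_poly (F : fieldType) n A B (f : 'I_B * 'I_B -> {poly F}) :
  (forall i, size (f i) <= A)%N -> (size (aux_poly n f) <= A + 2 * n * B)%N.
Proof.
move=> sf; apply: (leq_trans (size_sum _ _ _)); apply/bigmax_leqP => i _.
apply: leq_trans (size_polyMleq _ _) _.
have := size_polyMleq ('X^(n * i.1) : {poly F}) ((1 - 'X) ^+ (n * i.2)).
have := size_poly_exp_leq (1 - 'X : {poly F}) (n * i.2).
have : (size (1 - 'X : {poly F})%R <= 2)%N.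
  by rewrite -opprB size_polyN -[1]/(1%:P) size_XsubC.
rewrite size_polyXn; have := sf i; do 4!move: (size _) => ?.
have := leq_mul (leqnn n) (ltn_ord i.1); rewrite mulnS.
have := leq_mul (leqnn n) (ltn_ord i.2); rewrite mulnS.
nia.
Qed.

(** Counting: the conditions are |Q| A polynomials of size at most 2 A, which is
    2 |Q| A^2 linear equations, for A B^2 unknown coefficients. Over the finite
    field two choices of coefficients satisfy the same equations by the
    pigeonhole principle, and their difference is a solution. *)
Lemma exists_aux_poly (p n A B : nat) (Q : {set 'F_p * 'F_p}) :
  prime p -> (0 < A)%N -> (2 * #|Q| * A < B ^ 2)%N ->
  exists f : 'I_B * 'I_B -> {poly 'F_p},
    [/\ forall i, (size (f i) <= A)%N, exists i, f i != 0
      & forall q k, q \in Q -> (k < A)%N -> aux_xderiv n f q k = 0].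
Proof.
move=> pp A0 QB.
pose V := {ffun 'I_B * 'I_B -> 'rV['F_p]_A}.
pose W := {ffun 'I_#|Q| * 'I_A -> 'rV['F_p]_(2 * A)}.
pose phi (v : V) : W := [ffun x : 'I_#|Q| * 'I_A =>
  poly_rV (aux_xderiv n (fun i => rVpoly (v i)) (enum_val x.1) x.2)].
have WV : (#|W| < #|V|)%N.
  rewrite !card_ffun !card_prod !card_ord !card_mx !card_Fp // !mul1n.
  by rewrite -!expnM ltn_exp2l ?prime_gt1 //; nia.
have /injectivePn[v1 [v2 v12 phi12]] : ~~ injectiveb phi.
  by apply: contraL WV => /injectiveP /leq_card; rewrite leqNgt.
exists (fun i => rVpoly (v1 i) - rVpoly (v2 i)); split.
- move=> i; rewrite (leq_trans (size_polyD _ _)) // geq_max size_polyN.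
  by rewrite !size_poly.
- apply/existsP; apply: contraNT v12 => /existsPn h.
  apply/eqP/ffunP => i; apply: (can_inj rVpolyK); apply/eqP.
  by rewrite -subr_eq0; apply/negbNE/h.
move=> q k qQ kA.
have := congr1 (fun w : W => rVpoly (w (enum_rank_in qQ q, Ordinal kA))) phi12.
rewrite !ffunE !enum_rankK_in //.
have sz (v : V) : (size (aux_xderiv n (fun i => rVpoly (v i)) q k) <= 2 * A)%N.
  apply: (leq_trans (size_sum _ _ _)); apply/bigmax_leqP => i _.
  apply: leq_trans (size_scale_leq _ _) _.
  apply: leq_trans (size_iter_twist _ _ _ _) _.
  have : (size (rVpoly (v i)) <= A)%N by apply: size_poly.
  by move: (size _) kA => ? ; lia.
rewrite !poly_rV_K ?sz // => e.
apply/eqP; rewrite -[X in _ == X](subrr (aux_xderiv n (fun i => rVpoly (v2 i)) q k)).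
rewrite -{1}e /aux_xderiv -sumrB; apply/eqP/eq_bigr => i _.
by rewrite iter_twistB scalerBr.
Qed.

Lemma size_multiple_roots (F : fieldType) D (s : seq F) (f : {poly F}) :
  f != 0 -> uniq s -> {in s, forall t, ('X - t%:P) ^+ D %| f} ->
  (D * size s < size f)%N.
Proof.
move=> f0 us dv.
have : \prod_(t <- s) ('X - t%:P) ^+ D %| f.
  elim: s us dv => [|t s IH] /= us dv; first by rewrite big_nil dvd1p.
  case/andP: us => ts us; rewrite big_cons Gauss_dvdp; last first.
    rewrite big_seq; apply: (big_ind (coprimep _)) => [|u v cu cv|u us'].
    - by rewrite coprimep1.
    - by rewrite coprimepMr cu.
    rewrite coprimep_expl // coprimep_expr // coprimep_XsubC2 // subr_eq0.
    by apply: contraNneq ts => <-.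
  rewrite dv ?mem_head //=; apply: IH => // u us'.
  by rewrite dv // inE us' orbT.
move/(dvdp_leq f0); apply: leq_trans.
rewrite prodrXl; have := size_exp (\prod_(t <- s) ('X - t%:P)) D.
rewrite size_prod_XsubC /= mulnC => <-; rewrite prednK // size_poly_gt0.
by rewrite expf_neq0 // monic_neq0 // monic_prod_XsubC.
Qed.

Definition pow_preim (p n : nat) (Q : {set 'F_p * 'F_p}) : {set 'F_p} :=
  [set t | [&& t != 0, t != 1 & (t ^+ n, (1 - t) ^+ n) \in Q]].

(** The auxiliary polynomial vanishes to order A at each point of the preimage,
    so A times the number of these points is at most its degree. *)
Lemma stepanov (p n A B : nat) (Q : {set 'F_p * 'F_p}) :
  prime p -> (0 < A)%N -> (A * B <= n)%N -> (n * B <= p)%N ->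
  (2 * #|Q| * A < B ^ 2)%N -> (A * #|pow_preim n Q| <= A + 2 * n * B)%N.
Proof.
move=> pp A0 ABn nBp QB.
have [f [sf [i fi0] van]] := exists_aux_poly n pp A0 QB.
have Psi0 : aux_poly n f != 0.
  by apply: contraNneq fi0 => /(aux_poly_eq0 pp ABn nBp sf) ->.
have Ap : (A <= p)%N by nia.
rewrite cardE (leq_trans _ (size_aux_poly n sf)) // ltnW //.
apply: size_multiple_roots => //; first exact: enum_uniq.
move=> t; rewrite mem_enum inE => /and3P[t0 t1 tQ].
apply: xderiv_dvdp => // k kA.
by rewrite iter_xderiv_aux van // horner0.
Qed.

(** * Popular pairs of n-th powers *)

Lemma exists_subset_card (T : finType) (Q : {set T}) M :
  (M <= #|Q|)%N -> exists2 Q' : {set T}, Q' \subset Q & #|Q'| = M.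
Proof.
move=> MQ; exists [set x in take M (enum Q)].
  by apply/fintype.subsetP => x; rewrite inE => /mem_take; rewrite mem_enum.
have /card_uniqP : uniq (take M (enum Q)) by rewrite take_uniq ?enum_uniq.
rewrite cardsE => ->; rewrite size_take -cardE.
by case: ltngtP MQ.
Qed.

Lemma card_pow_preim_ge p n tau (Q : {set 'F_p * 'F_p}) :
  {in Q, forall q, (tau <= #|pow_preim n [set q]|)%N} ->
  (#|Q| * tau <= #|pow_preim n Q|)%N.
Proof.
move=> H; rewrite -[#|pow_preim n Q|]sum1_card.
rewrite (partition_big (fun t => (t ^+ n, (1 - t) ^+ n)) [in Q]) /=; last first.
  by move=> t; rewrite inE => /and3P[].
rewrite -sum_nat_const; apply: leq_sum => q qQ.
apply: leq_trans (H q qQ) _; rewrite sum1_card.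
apply: subset_leq_card; apply/fintype.subsetP => t; rewrite !inE.
by case/and3P => t0 t1 /eqP tq; rewrite unfold_in /= !inE t0 t1 tq qQ /=.
Qed.

(** Choice of the parameters for M pairs: B is about (2 M n)^(1/3) and A = n / B,
    the largest value allowed by A B <= n. The bounds on tau make B <= n and
    n B <= p, when M is about 54 * 1024 n^2 / tau^3; for M = 1 these hold
    because tau <= n forces n, hence p, to be large. *)
Lemma stepanov_params p n tau M :
  (0 < n)%N -> (n < p)%N -> (n ^ 3 <= p ^ 2)%N -> (tau <= n)%N ->
  (128 <= tau)%N -> (128 * n ^ 2 <= tau * p)%N -> (0 < M)%N ->
  (M.-1 * tau ^ 3 <= 54 * 1024 * n ^ 2)%N -> (54 * 1024 * n ^ 2 < M * tau ^ 3)%N ->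
  exists A B, [/\ (0 < A)%N, (A * B <= n)%N, (n * B <= p)%N,
    (2 * M * A < B ^ 2)%N & (n <= 2 * (A * B))%N /\ (B ^ 3 <= 16 * (M * n))%N].
Proof.
move=> n0 np n3 taun tau128 taup M0 M1 MM.
have exB : exists B, (2 * (M * n) < B ^ 3)%N.
  exists (2 * (M * n)).+1; apply: (@leq_trans ((2 * (M * n)).+1 ^ 1)).
    by rewrite expn1.
  by rewrite leq_exp2l // ltnS !muln_gt0 M0.
case: (ex_minnP exB) => B BM Bmin.
have B1 : (1 < B)%N.
  rewrite ltnNge; apply/negP => B1; move: BM.
  have : (B ^ 3 <= 1 ^ 3)%N by rewrite leq_exp2r.
  have : (0 < M * n)%N by rewrite muln_gt0 M0.
  by rewrite exp1n; lia.
have B16 : (B ^ 3 <= 16 * (M * n))%N.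
  have : ~~ (2 * (M * n) < B.-1 ^ 3)%N by apply/negP => /Bmin; lia.
  rewrite -leqNgt => h; have : (B ^ 3 <= (2 * B.-1) ^ 3)%N.
    by rewrite leq_exp2r //; lia.
  by rewrite expnMn; lia.
have [Bn nBp] : (B <= n)%N /\ (n * B <= p)%N.
  have [eM|M2] : M = 1%N \/ (M <= 2 * M.-1)%N by lia.
    rewrite eM !mul1n in MM B16.
    (* One pair only: tau^3 exceeds 54 * 1024 n^2 while tau <= n. *)
    have nbig : (54 * 1024 < n)%N.
      rewrite -(ltn_pmul2r (m := n ^ 2)) ?expn_gt0 ?n0 //.
      apply: leq_trans MM _; rewrite -expnS leq_exp2r //.
    split.
      rewrite -(leq_exp2r _ _ (e := 3)) //; apply: leq_trans B16 _.
      by rewrite !expnS expn0; nia.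
    rewrite -(leq_exp2r _ _ (e := 9)) // (expnM _ 3 3).
    apply: (@leq_trans ((16 * n ^ 4) ^ 3)).
      by rewrite leq_exp2r // expnMn [(n ^ 4)%N]expnSr mulnCA leq_mul2l B16 orbT.
    rewrite expnMn -expnM (expnM n 3 4).
    apply: (@leq_trans (16 ^ 3 * (p ^ 2) ^ 4)).
      by rewrite leq_mul2l leq_exp2r ?n3 ?orbT.
    rewrite -expnM [(p ^ 9)%N]expnS leq_mul2r; apply/orP; right.
    by change (16 ^ 3)%N with 4096%N; lia.
  (* Here M <= 2 (M - 1), and 32 * 54 * 1024 <= 128^3. *)
  have Bt : (B * tau <= 128 * n)%N.
    rewrite -(leq_exp2r _ _ (e := 3)) // !expnMn.
    apply: (@leq_trans (16 * (M * n) * tau ^ 3)).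
      by rewrite leq_mul2r B16 orbT.
    have : (M * tau ^ 3 <= 2 * (54 * 1024 * n ^ 2))%N.
      apply: (@leq_trans (2 * M.-1 * tau ^ 3)); first by rewrite leq_mul2r M2 orbT.
      by rewrite -mulnA leq_mul2l M1 orbT.
    move=> h; have := leq_mul (leqnn n) h; rewrite [(n ^ 3)%N]expnS.
    by move: (tau ^ 3)%N (n ^ 2)%N => x y; lia.
  split; first by nia.
  rewrite -(leq_pmul2r (m := tau)); last by lia.
  rewrite mulnC; apply: leq_trans (leq_trans taup _); last by rewrite mulnC.
  by move: (leq_mul (leqnn n) Bt); rewrite !expnS expn0; lia.
exists (n %/ B)%N, B.
have nB1 : (n %/ B * B <= n)%N by apply: leq_trunc_div.
have nB2 := divn_eq n B; have nB3 : (n %% B < B)%N by rewrite ltn_pmod //; lia.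
have A0 : (0 < n %/ B)%N by rewrite divn_gt0 //; lia.
split => //; last by split=> //; nia.
rewrite -(ltn_pmul2r (m := B)); last by lia.
rewrite -expnSr; apply: leq_ltn_trans BM.
by rewrite -!mulnA !leq_mul2l nB1 !orbT.
Qed.

(** If the bound failed, it would fail for some subset of Q of the least
    offending size M; Stepanov's bound gives M tau <= 6 B^2 with
    B^3 <= 16 M n, and cubing yields M tau^3 <= 216 * 256 n^2, which is the
    constant 54 * 1024. Passing to a subset is needed because the parameters
    of stepanov are admissible only when M is not too large. *)
Lemma popular_pairs_bound p n tau (Q : {set 'F_p * 'F_p}) :
  prime p -> (0 < n)%N -> (n < p)%N -> (n ^ 3 <= p ^ 2)%N -> (tau <= n)%N ->
  (128 <= tau)%N -> (128 * n ^ 2 <= tau * p)%N ->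
  {in Q, forall q, (tau <= #|pow_preim n [set q]|)%N} ->
  (#|Q| * tau ^ 3 <= 54 * 1024 * n ^ 2)%N.
Proof.
move=> pp n0 np n3 taun tau128 taup HQ; rewrite leqNgt; apply/negP => big.
have t0 : (0 < tau ^ 3)%N by rewrite expn_gt0; lia.
(* The least M with M tau^3 > 54 * 1024 n^2. *)
pose M := (54 * 1024 * n ^ 2 %/ tau ^ 3).+1.
have MM : (54 * 1024 * n ^ 2 < M * tau ^ 3)%N by apply: ltn_ceil.
have M1 : (M.-1 * tau ^ 3 <= 54 * 1024 * n ^ 2)%N by apply: leq_trunc_div.
have MQ : (M <= #|Q|)%N.
  by rewrite -(ltn_pmul2r t0) in M1 *; apply: leq_ltn_trans big.
have M0 : (0 < M)%N by [].
have [Q' Q'Q cQ'] := exists_subset_card MQ.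
have [A [B [A0 ABn nBp MAB [nAB B16]]]] :=
  stepanov_params n0 np n3 taun tau128 taup M0 M1 MM.
clearbody M.
rewrite -cQ' in MAB.
have st := stepanov pp A0 ABn nBp MAB; rewrite cQ' in MAB.
have : (#|Q'| * tau <= #|pow_preim n Q'|)%N.
  by apply: card_pow_preim_ge => q /(fintype.subsetP Q'Q); apply: HQ.
rewrite cQ'; move: (#|pow_preim n Q'|) st => S st MS.
have B0 : (0 < B)%N by case: (B) MAB.
have AnB : (A <= n * B)%N by nia.
have MB : (M * tau <= 6 * B ^ 2)%N.
  have AnB3 : (A + 2 * n * B <= 3 * (n * B))%N by lia.
  have st3 := leq_mul (leqnn (2 * B)) (leq_trans st AnB3).
  rewrite -(leq_pmul2l n0) (leq_trans (leq_mul nAB MS)) //.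
  have -> : (2 * (A * B) * S = 2 * B * (A * S))%N by lia.
  by apply: leq_trans st3 _; rewrite !expnS expn0; lia.
have : ((M * tau) ^ 3 <= (6 * B ^ 2) ^ 3)%N by rewrite leq_exp2r.
have -> : ((6 * B ^ 2) ^ 3 = 216 * (B ^ 3 * B ^ 3))%N by rewrite !expnS expn0; lia.
have := leq_mul B16 B16; move: (B ^ 3)%N => b hb.
rewrite expnMn => h.
have : (M ^ 2 * (M * tau ^ 3) <= M ^ 2 * (54 * 1024 * n ^ 2))%N.
  rewrite mulnA -expnSr (leq_trans h) //.
  by rewrite (leq_trans (leq_mul (leqnn 216) hb)) // !expnS expn0; lia.
by rewrite leq_pmul2l ?expn_gt0 ?M0 // leqNgt MM.
Qed.

(** * Points of a square of a subgroup on lines *)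

Lemma unit_val_neq0 p (u : {unit 'F_p}) : val u != 0.
Proof. by rewrite -unitfE; exact: valP. Qed.

Lemma card_unit_Fp p : prime p -> #|{: {unit 'F_p}}| = p.-1.
Proof. by move=> pp; rewrite -cardsT card_finField_unit card_Fp. Qed.

Lemma unit_of_neq0 p (x : 'F_p) : x != 0 -> exists u : {unit 'F_p}, val u = x.
Proof. by rewrite -unitfE => ux; exists (FinRing.unit _ ux). Qed.

(** Double counting of pairs (i, z) with z in S i, each z occurring once. *)
Lemma sum_card_le (I Z : finType) (S : I -> {set Z}) (W : {set Z}) :
  (forall i z, z \in S i -> z \in W) ->
  (forall i j z, z \in S i -> z \in S j -> i = j) ->
  (\sum_i #|S i| <= #|W|)%N.
Proof.
move=> SW inj; under eq_bigr => i _ do rewrite -sum1_card.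
rewrite (exchange_big_dep [in W]) /=; last by move=> i z _; apply: SW.
rewrite -[#|W|]sum1_card; apply: leq_sum => z zW.
rewrite sum1_card; apply/card_le1_eqP => i j; rewrite !unfold_in /= => zi zj.
exact: (inj j i z).
Qed.

Lemma card_le_sum (I Z : finType) (S : I -> {set Z}) (W : {set Z}) :
  (forall z, z \in W -> exists i, z \in S i) -> (#|W| <= \sum_i #|S i|)%N.
Proof.
move=> WS; apply: (@leq_trans #|\bigcup_i S i|).
  apply: subset_leq_card; apply/fintype.subsetP => z /WS[i zi].
  by apply/finset.bigcupP; exists i.
elim/big_rec2: _ => [|i m A _ Am]; first by rewrite cards0.
by rewrite (leq_trans (leq_card_setU _ _)) ?leq_add2l.
Qed.

Definition offdiag (T : finType) (A : {set T}) : {set T * T} :=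
  [set xy in finset.setX A A | xy.1 != xy.2].

Lemma in_offdiag (T : finType) (A : {set T}) (xy : T * T) :
  (xy \in offdiag A) = [&& xy.1 \in A, xy.2 \in A & xy.1 != xy.2].
Proof. by case: xy => x y; rewrite !inE /= -andbA. Qed.

Lemma card_offdiag (T : finType) (A : {set T}) :
  #|offdiag A| = (#|A| * #|A|.-1)%N.
Proof.
have -> : offdiag A = finset.setX A A :\: [set (x, x) | x in A].
  apply/setP => -[x y]; rewrite !inE /= andbC; case: (boolP (x \in A)) => //= xA.
    congr (_ && _); congr (~~ _); apply/eqP/imsetP => [<-|[z _ [-> ->]] //].
    by exists x.
  by rewrite !andbF.
rewrite cardsD cardsX (finset.setIidPr _); last first.
  by apply/fintype.subsetP => _ /imsetP[x xA ->]; rewrite inE /= xA.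
rewrite card_imset; last by move=> x y [].
by case: #|A| => // a; lia.
Qed.

(** The pair l stands for the line l.1 x + l.2 y = 1; these are the lines that
    miss the origin and are parallel to no axis. *)
Definition on_line p (l x : {unit 'F_p} * {unit 'F_p}) : bool :=
  val l.1 * val x.1 + val l.2 * val x.2 == 1.

Definition line_pts p (G : {set {unit 'F_p}}) (l : {unit 'F_p} * {unit 'F_p}) :
    {set {unit 'F_p} * {unit 'F_p}} :=
  [set x in finset.setX G G | on_line l x].

Lemma in_line_pts p (G : {set {unit 'F_p}}) (l x : {unit 'F_p} * {unit 'F_p}) :
  (x \in line_pts G l) = [&& x.1 \in G, x.2 \in G & on_line l x].
Proof. by case: x => x1 x2; rewrite !inE /= -andbA. Qed.

Lemma on_line_fst_inj p (l x y : {unit 'F_p} * {unit 'F_p}) :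
  on_line l x -> on_line l y -> x.1 = y.1 -> x = y.
Proof.
case: x y => [x1 x2] [y1 y2]; rewrite /on_line /= => /eqP ex /eqP ey e1.
rewrite -e1 -ex in ey *; move/addrI/(mulfI (unit_val_neq0 _))/val_inj: ey.
by move=> ->.
Qed.

(** Two points on two distinct lines alpha x + beta y = 1 would be proportional,
    and proportional points on such a line coincide. *)
Lemma line_coef_inj (F : fieldType) (l1 l2 m1 m2 x1 x2 y1 y2 : F) :
  x2 != 0 -> y2 != 0 -> (x1, x2) != (y1, y2) ->
  l1 * x1 + l2 * x2 = 1 -> l1 * y1 + l2 * y2 = 1 ->
  m1 * x1 + m2 * x2 = 1 -> m1 * y1 + m2 * y2 = 1 -> l1 = m1 /\ l2 = m2.
Proof.
move=> X2 Y2 ne lx ly mx my.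
have [e1|n1] := eqVneq l1 m1.
  by move: lx; rewrite -mx e1 => /addrI/(mulIf X2) ->.
have det : x1 * y2 = x2 * y1.
  apply: (mulfI (x := l1 - m1)); first by rewrite subr_eq0.
  apply/eqP; rewrite -subr_eq0; apply/eqP.
  transitivity (y2 * ((l1 * x1 + l2 * x2) - (m1 * x1 + m2 * x2))
              - x2 * ((l1 * y1 + l2 * y2) - (m1 * y1 + m2 * y2))); first by ring.
  by rewrite lx ly mx my !subrr !mulr0 subrr.
have e2 : x2 = y2.
  rewrite -[LHS]mulr1 -ly -[RHS]mulr1 -lx.
  transitivity (l1 * (x2 * y1) + l2 * x2 * y2); first by ring.
  by rewrite -det; ring.
by move: det ne; rewrite e2 [RHS]mulrC => /(mulIf Y2) ->; rewrite eqxx.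
Qed.

Lemma on_line_inj p (l m x y : {unit 'F_p} * {unit 'F_p}) : x != y ->
  on_line l x -> on_line l y -> on_line m x -> on_line m y -> l = m.
Proof.
case: x y l m => [x1 x2] [y1 y2] [l1 l2] [m1 m2]; rewrite /on_line /=.
move=> ne /eqP lx /eqP ly /eqP mx /eqP my.
have neq : (val x1, val x2) != (val y1, val y2).
  by apply: contraNneq ne => -[/val_inj -> /val_inj ->].
have [/val_inj -> /val_inj ->] // := line_coef_inj
  (unit_val_neq0 x2) (unit_val_neq0 y2) neq lx ly mx my.
Qed.

Section Moments.
Variables (p : nat) (G : {group {unit 'F_p}}).
Hypothesis pp : prime p.
Let n := #|G|.
Local Notation N := (fun l => #|line_pts G l|).

Lemma line_pts_le l : (N l <= n)%N.
Proof.
have inj : {in line_pts G l &, injective fst}.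
  move=> x y; rewrite !inE => /andP[_ lx] /andP[_ ly].
  exact: on_line_fst_inj lx ly.
rewrite -(card_in_imset inj).
apply: subset_leq_card; apply/fintype.subsetP => _ /imsetP[x + ->].
by rewrite !inE => /andP[/andP[]].
Qed.

(** The substitution t = alpha x: elements of G are n-th roots of unity, so
    t^n = alpha^n and (1 - t)^n = (beta y)^n = beta^n. *)
Lemma line_pts_le_pow_preim l :
  (N l <= #|pow_preim n [set (val l.1 ^+ n, val l.2 ^+ n)]|)%N.
Proof.
have l1 := unit_val_neq0 l.1; have l2 := unit_val_neq0 l.2.
have powG (x : {unit 'F_p}) : x \in G -> val x ^+ n = 1.
  by move=> xG; rewrite -FinRing.val_unitX expg_cardG.
have inj : {in line_pts G l &, injective (fun x => val l.1 * val x.1)}.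
  move=> x y; rewrite !inE => /andP[_ lx] /andP[_ ly].
  by move/(mulfI l1)/val_inj; apply: on_line_fst_inj lx ly.
rewrite -(card_in_imset inj).
apply: subset_leq_card; apply/fintype.subsetP => _ /imsetP[x + ->].
rewrite !inE /on_line => /andP[/andP[x1 x2] /eqP lx].
have e2 : 1 - val l.1 * val x.1 = val l.2 * val x.2 by rewrite -lx; ring.
rewrite mulf_neq0 ?unit_val_neq0 //= e2 !exprMn (powG _ x1) (powG _ x2) !mulr1.
rewrite eqxx andbT.
by rewrite eq_sym -subr_eq0 e2 mulf_neq0 ?unit_val_neq0.
Qed.

Lemma card_unit_roots (c : 'F_p) :
  (#|[set a : {unit 'F_p} | val a ^+ n == c]| <= n)%N.
Proof.
have n0 : (0 < n)%N := cardG_gt0 G.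
rewrite -(card_imset _ val_inj) cardE.
have := @max_poly_roots _ ('X^n - c%:P)
  (enum (val @: [set a : {unit 'F_p} | val a ^+ n == c])).
rewrite size_XnsubC // ltnS; apply; rewrite ?enum_uniq //.
  by rewrite -size_poly_eq0 size_XnsubC.
apply/allP => x; rewrite mem_enum => /imsetP[a]; rewrite inE => /eqP ac ->.
by rewrite rootE !hornerE ac subrr.
Qed.

(** The pair (alpha^n, beta^n) is the same for at most n^2 lines, so the number
    of rich lines is at most n^2 times the number of popular pairs. *)
Lemma level_set_bound tau : (n ^ 3 <= p ^ 2)%N -> (128 <= tau)%N ->
  (128 * n ^ 2 <= tau * p)%N ->
  (#|[set l | tau <= N l]| * tau ^ 3 <= 54 * 1024 * n ^ 4)%N.
Proof.
move=> n3 t128 tp; set L := [set l | _].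
have n0 : (0 < n)%N := cardG_gt0 G.
have np : (n < p)%N.
  have := max_card [in G]; rewrite -/n card_unit_Fp //.
  by have := prime_gt1 pp; lia.
have [tn|nt] := leqP tau n; last first.
  rewrite (_ : L = finset.set0) ?cards0 //; apply/setP => l.
  by rewrite !inE leqNgt (leq_ltn_trans (line_pts_le l)).
pose f (l : {unit 'F_p} * {unit 'F_p}) := (val l.1 ^+ n, val l.2 ^+ n).
have LQ : (#|L| <= n ^ 2 * #|f @: L|)%N.
  rewrite -sum1_card (partition_big f [in f @: L]) /=; last first.
    by move=> l lL; apply: imset_f.
  rewrite mulnC -sum_nat_const; apply: leq_sum => -[q1 q2] _.
  rewrite sum1_card (leq_trans _ (leq_mul (card_unit_roots q1) (card_unit_roots q2))) //.
  rewrite -cardsX; apply: subset_leq_card; apply/fintype.subsetP => -[l1 l2].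
  by rewrite unfold_in /= => /andP[_]; rewrite xpair_eqE !inE.
have := @popular_pairs_bound p n tau (f @: L) pp n0 np n3 tn t128 tp.
have H : {in f @: L, forall q, tau <= #|pow_preim n [set q]|}%N.
  move=> _ /imsetP[l + ->]; rewrite inE => tl.
  exact: leq_trans tl (line_pts_le_pow_preim l).
move/(_ H); move: (54 * 1024)%N => c; move: (#|f @: L|) LQ => q LQ h.
rewrite (leq_trans (leq_mul LQ (leqnn _))) //.
rewrite -mulnA (leq_trans (leq_mul (leqnn _) h)) //.
by rewrite !expnS expn0; lia.
Qed.

Lemma card_lines_through (x : {unit 'F_p} * {unit 'F_p}) :
  #|[set l | on_line l x]| = (p - 2)%N.
Proof.
have x1 := unit_val_neq0 x.1; have x2 := unit_val_neq0 x.2.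
have inj : {in [set l | on_line l x] &, injective fst}.
  move=> [l1 l2] [m1 m2]; rewrite !inE /on_line /= => /eqP lx /eqP + e.
  by rewrite -lx e => /addrI/(mulIf x2)/val_inj ->.
rewrite -(card_in_imset inj).
rewrite (_ : _ @: _ = [set~ x.1^-1%g]) ?cardsC1 ?card_unit_Fp //; first by lia.
apply/setP => a; rewrite !inE; apply/imsetP/idP.
  case=> l; rewrite inE /on_line => lx ->; apply: contraTneq lx => ->.
  rewrite FinRing.val_unitV mulVf // -subr_eq0 addrC addKr.
  by rewrite mulf_neq0 ?unit_val_neq0.
move=> ax.
have nz : (1 - val a * val x.1) / val x.2 != 0.
  rewrite mulf_neq0 ?invr_eq0 // subr_eq0; apply: contraNneq ax => ax.
  apply/eqP/val_inj; rewrite FinRing.val_unitV.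
  by apply: (mulIf x1); rewrite mulVf.
have [b bE] := unit_of_neq0 nz.
exists (a, b) => //; rewrite inE /on_line /= bE divfK //.
by rewrite addrC subrK.
Qed.

Lemma sum_line_pts : (\sum_l N l = n ^ 2 * (p - 2))%N.
Proof.
under eq_bigr => l _ do rewrite -sum1_card.
rewrite (exchange_big_dep [in finset.setX G G]) /=; last first.
  by move=> l x _; rewrite inE => /andP[].
rewrite -mulnn -cardsX -sum_nat_const; apply: eq_bigr => x xG.
rewrite -(card_lines_through x) -sum1_card; apply: eq_bigl => l.
by move: xG; rewrite !inE => ->.
Qed.

(** Two distinct points lie on at most one line. *)
Lemma sum_line_pairs : (\sum_l N l * (N l).-1 <= n ^ 4)%N.
Proof.
under eq_bigr => l _ do rewrite -card_offdiag.
have -> : (n ^ 4)%N = #|finset.setX (finset.setX G G) (finset.setX G G)|.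
  by rewrite !cardsX -/n !expnS expn0; lia.
apply: (@sum_card_le _ _ (fun l => offdiag (line_pts G l))
  (finset.setX (finset.setX G G) (finset.setX G G))).
- move=> l [x y] xy; rewrite in_offdiag /= in xy; case/and3P: xy => lx ly _.
  rewrite in_line_pts in lx; rewrite in_line_pts in ly.
  case/and3P: lx => x1 x2 _; case/and3P: ly => y1 y2 _.
  by apply/finset.setXP; split; rewrite inE; apply/andP.
- move=> l m [x y] hl hm; rewrite in_offdiag /= in hl; rewrite in_offdiag /= in hm.
  case/and3P: hl => lx ly ne; case/and3P: hm => mx my _.
  move: lx ly mx my; rewrite !in_line_pts.
  case/and3P=> _ _ lx /and3P[_ _ ly] /and3P[_ _ mx] /and3P[_ _ my].
  exact: on_line_inj ne lx ly mx my.
Qed.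

End Moments.

(** * Collinear triples *)

(** With the equations of the line, both differences l1 (u1 - v1) and
    l1 (u1 - w1) turn into the corresponding multiples of -l2. *)
Lemma collinear_ratio (F : fieldType) (l1 l2 u1 u2 v1 v2 w1 w2 : F) :
  l1 != 0 -> l2 != 0 -> u1 - w1 != 0 -> u2 - w2 != 0 ->
  l1 * u1 + l2 * u2 = 1 -> l1 * v1 + l2 * v2 = 1 -> l1 * w1 + l2 * w2 = 1 ->
  (u1 - v1) / (u1 - w1) = (u2 - v2) / (u2 - w2).
Proof.
move=> L1 L2 d1 d2 lu lv lw; apply/eqP; rewrite eqr_div // -subr_eq0.
apply/eqP/(mulfI (x := l1 * l2)); first by rewrite mulf_neq0.
transitivity (l2 * (u2 - w2) * ((l1 * u1 + l2 * u2) - (l1 * v1 + l2 * v2))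
  - l2 * (u2 - v2) * ((l1 * u1 + l2 * u2) - (l1 * w1 + l2 * w2))); first by ring.
by rewrite lu lv lw subrr !mulr0 subrr.
Qed.

(** Let d = u1 w2 - u2 w1. If d is nonzero, Cramer's rule gives the line through
    the points u and w, and the ratio condition puts v on it; if d = 0, then u
    and w lie on a line through the origin, and so does v. *)
Lemma ratio_collinear (F : fieldType) (u1 u2 v1 v2 w1 w2 : F) :
  u1 - w1 != 0 -> u2 - w2 != 0 ->
  (u1 - v1) / (u1 - w1) = (u2 - v2) / (u2 - w2) ->
  (u1 * w2 = u2 * w1 /\ u1 * v2 = u2 * v1) \/
  exists l1 l2, [/\ l1 != 0, l2 != 0 & [/\ l1 * u1 + l2 * u2 = 1,
     l1 * v1 + l2 * v2 = 1 & l1 * w1 + l2 * w2 = 1]].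
Proof.
move=> d1 d2 /eqP; rewrite eqr_div // -subr_eq0 => /eqP X0.
have [de|de] := eqVneq (u1 * w2 - u2 * w1) 0.
  left; split; first by apply/eqP; rewrite -subr_eq0 de.
  apply/eqP; rewrite -subr_eq0; apply/eqP/(mulfI d1); rewrite mulr0.
  (* The first summand vanishes by the ratio condition, the second as d = 0. *)
  transitivity (u1 * ((u1 - v1) * (u2 - w2) - (u2 - v2) * (u1 - w1))
    + (u1 - v1) * (u1 * w2 - u2 * w1)); first by ring.
  by rewrite X0 de !mulr0 addr0.
right; exists ((w2 - u2) / (u1 * w2 - u2 * w1)), ((u1 - w1) / (u1 * w2 - u2 * w1)).
split; [|by rewrite mulf_neq0 ?invr_eq0|].
  by rewrite mulf_neq0 ?invr_eq0 // -opprB oppr_eq0.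
split; [by field| |by field].
transitivity ((u1 * w2 - u2 * w1 + ((u1 - v1) * (u2 - w2) - (u2 - v2) * (u1 - w1)))
  / (u1 * w2 - u2 * w1)); first by field.
by rewrite X0 addr0 divff.
Qed.

Lemma on_linePair p (a b x y : {unit 'F_p}) :
  on_line (a, b) (x, y) = (val a * val x + val b * val y == 1).
Proof. by []. Qed.

(** The points (x, y) of G x G on this line are the points (x, lambda y) of
    G x lambda G on l. *)
Definition scale_line p (lambda : {unit 'F_p}) (l : {unit 'F_p} * {unit 'F_p}) :=
  (l.1, (l.2 * lambda)%g).

Lemma scale_line_bij p (lambda : {unit 'F_p}) : bijective (scale_line lambda).
Proof.
exists (scale_line lambda^-1%g) => -[l1 l2]; rewrite /scale_line /=.
  by rewrite mulgK.
by rewrite mulgKV.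
Qed.

Section Count.
Variables (p : nat) (G : {group {unit 'F_p}}).
Let U : Type := {unit 'F_p}.
Let n := #|G|.
Local Notation N := (fun l => #|line_pts G l|).

Lemma sum_scale_line (R : nmodType) (lambda : {unit 'F_p}) (phi : nat -> R) :
  \sum_l phi (N (scale_line lambda l)) = \sum_l phi (N l).
Proof.
rewrite [RHS](reindex (scale_line lambda)) //; apply: onW_bij.
exact: scale_line_bij.
Qed.

Lemma line_pts_orbit_le l g h : g \in G -> h \in G ->
  (N ((l.1 * g)%g, (l.2 * h)%g) <= N l)%N.
Proof.
move=> gG hG; pose f (x : {unit 'F_p} * {unit 'F_p}) := ((g * x.1)%g, (h * x.2)%g).
have inj : injective f by move=> [x1 x2] [y1 y2] /eqP;
    rewrite xpair_eqE /= => /andP[/eqP/mulgI -> /eqP/mulgI ->].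
rewrite -(card_imset _ inj); apply: subset_leq_card; apply/fintype.subsetP => y.
case/imsetP=> x; rewrite in_line_pts => /and3P[x1 x2 lx] ->.
rewrite in_line_pts !groupM //=; move: lx.
rewrite [l]surjective_pairing [x]surjective_pairing !on_linePair.
by rewrite !FinRing.val_unitM !mulrA.
Qed.

Lemma line_pts_orbit l g h : g \in G -> h \in G ->
  N ((l.1 * g)%g, (l.2 * h)%g) = N l.
Proof.
move=> gG hG; apply/eqP; rewrite eqn_leq line_pts_orbit_le //=.
have := @line_pts_orbit_le ((l.1 * g)%g, (l.2 * h)%g) g^-1%g h^-1%g.
by rewrite /= !mulgK -surjective_pairing !groupV; apply.
Qed.

(** G x G acts freely on the lines and preserves the number of points, so the
    value at l is taken at least n^2 times. *)
Lemma orbit_sum_le (R : numDomainType) (phi : nat -> R) l :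
  (forall k, 0 <= phi k) -> (n ^ 2)%:R * phi (N l) <= \sum_m phi (N m).
Proof.
move=> phi0.
pose f (g : {unit 'F_p} * {unit 'F_p}) := ((l.1 * g.1)%g, (l.2 * g.2)%g).
have inj : injective f by move=> [x1 x2] [y1 y2] /eqP;
    rewrite xpair_eqE /= => /andP[/eqP/mulgI -> /eqP/mulgI ->].
rewrite -mulnn -cardsX -(card_imset _ inj) mulr_natl -sumr_const.
rewrite [X in _ <= X](bigID [in f @: finset.setX G G]) /= ler_wpDr ?sumr_ge0 //.
apply: ler_sum => _ /imsetP[[g h] /finset.setXP[gG hG] ->].
by rewrite line_pts_orbit.
Qed.

Definition triples (l : {unit 'F_p} * {unit 'F_p}) (lambda : {unit 'F_p}) :=
  finset.setX (line_pts G l) (offdiag (line_pts G (scale_line lambda l))).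

Lemma in_triples lambda l (z : (U * U) * ((U * U) * (U * U))) :
  (z \in triples l lambda) = [&& z.1 \in line_pts G l,
    z.2.1 \in line_pts G (scale_line lambda l),
    z.2.2 \in line_pts G (scale_line lambda l) & z.2.1 != z.2.2].
Proof. by case: z => x yz; rewrite finset.in_setX in_offdiag. Qed.

(** Three points in the plane, seen as the sextuple of their coordinates in the
    order used by Tcount. *)
Definition regroup (z : (U * U) * ((U * U) * (U * U))) : (U * U * U) * (U * U * U) :=
  ((z.1.1, z.2.1.1, z.2.2.1), (z.1.2, z.2.1.2, z.2.2.2)).

Definition Tset (lambda : {unit 'F_p}) : {set (U * U) * ((U * U) * (U * U))} :=
  [set z |
   [&& [&& z.1 \in finset.setX G G, z.2.1 \in finset.setX G G
         & z.2.2 \in finset.setX G G],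
       val z.1.1 - val z.2.2.1 != 0, val z.1.2 - val lambda * val z.2.2.2 != 0
     & (val z.1.1 - val z.2.1.1) / (val z.1.1 - val z.2.2.1)
       == (val z.1.2 - val lambda * val z.2.1.2)
          / (val z.1.2 - val lambda * val z.2.2.2)]].

Lemma Tsubgroup_card lambda : Tsubgroup lambda G = #|Tset lambda|.
Proof.
have bij : bijective regroup.
  by exists (fun z => ((z.1.1.1, z.2.1.1), ((z.1.1.2, z.2.1.2), (z.1.2, z.2.2))))
    => [[[? ?] [[? ?] [? ?]]]|[[[? ?] ?] [[? ?] ?]]].
rewrite /Tsubgroup /Tcount -(on_card_preimset (f := regroup)); last exact: onW_bij.
apply: eq_card => -[[u1 u2] [[v1 v2] [w1 w2]]].
rewrite !finset.in_set /= !mul1r !subr_eq0.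
case: (u1 \in G); case: (u2 \in G); case: (v1 \in G); case: (v2 \in G);
  by case: (w1 \in G); case: (w2 \in G).
Qed.

End Count.

Section Triples.
Variables (p : nat) (G : {group {unit 'F_p}}) (lambda : {unit 'F_p}).
Let U : Type := {unit 'F_p}.
Let n := #|G|.
Let GG : {set U * U} := finset.setX G G.

(** Each degenerate family of triples is determined by two points of G x G. *)
Lemma card_param_le (D : {set (U * U) * ((U * U) * (U * U))})
    (f : (U * U) * ((U * U) * (U * U)) -> (U * U) * (U * U)) :
  {in D &, injective f} -> (forall z, z \in D -> f z \in finset.setX GG GG) ->
  (#|D| <= n ^ 4)%N.
Proof.
move=> inj fG; rewrite -(card_in_imset inj).
have -> : (n ^ 4)%N = #|finset.setX GG GG|.
  by rewrite !cardsX -/n !expnS expn0; lia.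
by apply: subset_leq_card; apply/fintype.subsetP => _ /imsetP[z zD ->]; apply: fG.
Qed.

(** Triples on a line whose first and third points coincide: they are not counted
    by T, since both denominators vanish. *)
Definition deg_PR : {set (U * U) * ((U * U) * (U * U))} :=
  [set z | [&& z.1 \in GG, z.2.1 \in GG, val z.2.2.1 == val z.1.1
             & val lambda * val z.2.2.2 == val z.1.2]].

(** Coinciding second and third points: T counts them, but they may lie on several
    lines. *)
Definition deg_QR : {set (U * U) * ((U * U) * (U * U))} :=
  [set z | [&& z.1 \in GG, z.2.1 \in GG & z.2.2 == z.2.1]].

(** Triples on a line through the origin, which is not of the form
    alpha x + beta y = 1. *)
Definition deg_origin : {set (U * U) * ((U * U) * (U * U))} :=
  [set z | [&& z.1 \in GG, (z.2.1.1, z.2.2.1) \in GG,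
       val z.1.1 * (val lambda * val z.2.1.2) == val z.1.2 * val z.2.1.1
     & val z.1.1 * (val lambda * val z.2.2.2) == val z.1.2 * val z.2.2.1]].

Lemma card_deg_PR : (#|deg_PR| <= n ^ 4)%N.
Proof.
apply: (@card_param_le _ (fun z => (z.1, z.2.1))) => [|z]; last first.
  rewrite finset.in_set => /and4P[zP zQ _ _].
  by apply/finset.setXP.
move=> [P [Q [w1 w2]]] [P' [Q' [w1' w2']]].
rewrite !finset.in_set; case/and4P => _ _ /eqP a1 /eqP a2.
case/and4P => _ _ /eqP b1 /eqP b2 /eqP; rewrite xpair_eqE => /andP[/eqP eP /eqP eQ].
rewrite /= in a1 a2 b1 b2 eP eQ; subst P' Q'.
rewrite -b1 in a1; rewrite -b2 in a2.
by rewrite (val_inj a1) (val_inj (mulfI (unit_val_neq0 lambda) a2)).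
Qed.

Lemma card_deg_QR : (#|deg_QR| <= n ^ 4)%N.
Proof.
apply: (@card_param_le _ (fun z => (z.1, z.2.1))) => [|z]; last first.
  rewrite finset.in_set => /and3P[zP zQ _].
  by apply/finset.setXP.
move=> [P [Q R]] [P' [Q' R']].
rewrite !finset.in_set; case/and3P => _ _ /eqP a.
case/and3P => _ _ /eqP b /eqP; rewrite xpair_eqE => /andP[/eqP eP /eqP eQ].
by rewrite /= in a b eP eQ; rewrite a b eP eQ.
Qed.

Lemma card_deg_origin : (#|deg_origin| <= n ^ 4)%N.
Proof.
apply: (@card_param_le _ (fun z => (z.1, (z.2.1.1, z.2.2.1)))) => [|z]; last first.
  rewrite finset.in_set => /and4P[zP zQ _ _].
  by apply/finset.setXP.
move=> [[u1 u2] [[v1 v2] [w1 w2]]] [P' [[v1' v2'] [w1' w2']]].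
rewrite !finset.in_set; case/and4P => _ _ /eqP a1 /eqP a2.
case/and4P => _ _ /eqP b1 /eqP b2 /eqP; rewrite !xpair_eqE.
case/and3P=> /eqP eP /eqP ev /eqP ew.
rewrite /= in a1 a2 b1 b2 eP ev ew; subst P' v1' w1'.
rewrite /= -b1 in a1; rewrite /= -b2 in a2.
have cancel (x y : {unit 'F_p}) :
    val u1 * (val lambda * val x) = val u1 * (val lambda * val y) -> x = y.
  by move/(mulfI (unit_val_neq0 u1))/(mulfI (unit_val_neq0 lambda))/val_inj.
by rewrite (cancel _ _ a1) (cancel _ _ a2).
Qed.

Lemma card_triples l :
  #|triples G l lambda| = (#|line_pts G l|
     * (#|line_pts G (scale_line lambda l)| * (#|line_pts G (scale_line lambda l)|).-1))%N.
Proof. by rewrite cardsX card_offdiag. Qed.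

Lemma on_scale_line (l x : {unit 'F_p} * {unit 'F_p}) :
  on_line (scale_line lambda l) x ->
  val l.1 * val x.1 + val l.2 * (val lambda * val x.2) = 1.
Proof.
case: l x => [l1 l2] [x1 x2]; rewrite on_linePair FinRing.val_unitM => /eqP <-.
by rewrite mulrA.
Qed.

(** The points Q and R are distinct, so a triple determines its line; on a line
    that is parallel to no axis the denominators vanish only if P = R. *)
Lemma sum_triples_le :
  (\sum_l #|triples G l lambda| <= #|Tset G lambda| + n ^ 4)%N.
Proof.
apply: (@leq_trans #|Tset G lambda :|: deg_PR|); last first.
  by rewrite (leq_trans (leq_card_setU _ _)) // leq_add2l card_deg_PR.
apply: sum_card_le => [l z|l m z].
  rewrite in_triples !in_line_pts => /and4P[/and3P[u1 u2 lu] /and3P[v1 v2 lv]].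
  case/and3P=> w1 w2 lw ne; move: lu lv lw.
  move=> /eqP lu /on_scale_line lv /on_scale_line lw.
  have l1 := unit_val_neq0 l.1; have l2 := unit_val_neq0 l.2.
  apply/finset.setUP; rewrite [z \in deg_PR]finset.in_set.
  rewrite [z \in Tset _ _]finset.in_set.
  have inGG (x : {unit 'F_p} * {unit 'F_p}) : x.1 \in G -> x.2 \in G -> x \in GG.
    by case: x => a b aG bG; apply/finset.setXP.
  rewrite -/GG !inGG // !andTb.
  have [e1|n1] := eqVneq (val z.2.2.1) (val z.1.1).
    right; rewrite andTb; apply/eqP.
    by move: lu; rewrite -lw e1 => /addrI/(mulfI l2) ->.
  have [e2|n2] := eqVneq (val lambda * val z.2.2.2) (val z.1.2).
    by move: lu n1; rewrite -lw e2 => /addIr/(mulfI l1) ->; rewrite eqxx.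
  left; rewrite !subr_eq0 !(eq_sym (val z.1.1)) !(eq_sym (val z.1.2)) n1 n2 !andTb.
  apply/eqP; apply: (collinear_ratio l1 l2 _ _ lu lv lw).
    by rewrite subr_eq0 eq_sym.
  by rewrite subr_eq0 eq_sym.
move=> zl zm; rewrite in_triples !in_line_pts in zl.
rewrite in_triples !in_line_pts in zm.
case/and4P: zl => _ /and3P[_ _ lv] /and3P[_ _ lw] ne.
case/and4P: zm => _ /and3P[_ _ mv] /and3P[_ _ mw] _.
apply: (bij_inj (scale_line_bij lambda)).
exact: on_line_inj ne lv lw mv mw.
Qed.

Lemma Tset_le_sum_triples :
  (#|Tset G lambda| <= \sum_l #|triples G l lambda| + 2 * n ^ 4)%N.
Proof.
pose D := deg_QR :|: deg_origin.
have cD : (#|D| <= 2 * n ^ 4)%N.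
  rewrite (leq_trans (leq_card_setU _ _)) // mul2n -addnn.
  by rewrite leq_add ?card_deg_QR ?card_deg_origin.
rewrite -(cardsID D) addnC leq_add //; last first.
  by apply: leq_trans cD; apply: subset_leq_card; apply: finset.subsetIr.
apply: card_le_sum => z /finset.setDP[].
rewrite finset.in_set => /and4P[/and3P[zu zv zw] d1 d2 /eqP ratio] zD.
have GGP (x : {unit 'F_p} * {unit 'F_p}) : x \in GG -> (x.1 \in G) && (x.2 \in G).
  by case: x => a b /finset.setXP[-> ->].
have [/andP[u1 u2] [/andP[v1 v2] /andP[w1 w2]]] := (GGP _ zu, (GGP _ zv, GGP _ zw)).
have QR : z.2.1 != z.2.2.
  apply: contraNneq zD => e; apply/finset.setUP; left.
  by rewrite finset.in_set zu zv e eqxx.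
case: (ratio_collinear d1 d2 ratio) => [[ew ev]|].
  case/negP: zD; apply/finset.setUP; right; rewrite finset.in_set zu ev ew !eqxx.
  have -> // : (z.2.1.1, z.2.2.1) \in GG by apply/finset.setXP.
case=> a [b [a0 b0 [lu lv lw]]].
have [l1 l1E] := unit_of_neq0 a0; have [l2 l2E] := unit_of_neq0 b0.
have onS (x : {unit 'F_p} * {unit 'F_p}) :
    a * val x.1 + b * (val lambda * val x.2) = 1 -> on_line (scale_line lambda (l1, l2)) x.
  case: x => x1 x2 h; rewrite on_linePair FinRing.val_unitM l1E l2E.
  by rewrite -mulrA; apply/eqP.
exists (l1, l2); rewrite in_triples !in_line_pts u1 u2 v1 v2 w1 w2 QR !onS //= andbT.
by rewrite /on_line l1E l2E; apply/eqP.
Qed.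

End Triples.

(** * Moments over the lines *)

Lemma sumr_cst (R : pzRingType) (I : finType) (x : R) :
  \sum_(i : I) x = #|I|%:R * x.
Proof. by rewrite sumr_const mulr_natl. Qed.

Section SecondMoment.
Variables (R : realType) (I : finType) (a : I -> R) (P n : R).
Hypotheses (P0 : 1 <= P) (n0 : 0 <= n) (nP : n <= P).
Hypothesis cardI : #|I|%:R = (P - 1) ^+ 2.
Hypothesis suma : \sum_i a i = n ^+ 2 * (P - 2).
Hypothesis sqa : \sum_i a i ^+ 2 <= n ^+ 4 + n ^+ 2 * (P - 2).
Let mu := n ^+ 2 / P.

Lemma sum_centred : \sum_i (a i - mu) = - mu.
Proof.
have Pn0 : P != 0 by rewrite gt_eqF // (lt_le_trans ltr01).
rewrite sumrB suma sumr_cst cardI /mu.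
by field.
Qed.

(** Expand the square; with the exact first moment the terms of order n^4 cancel
    up to O(n^4 / P). *)
Lemma variance_le : \sum_i (a i - mu) ^+ 2 <= 4 * (n ^+ 2 * P).
Proof.
have Pp : 0 < P := lt_le_trans ltr01 P0.
have Pn0 : P != 0 by rewrite gt_eqF.
have -> : \sum_i (a i - mu) ^+ 2 = \sum_i a i ^+ 2 - 2 * mu * (\sum_i a i)
    + mu ^+ 2 * (P - 1) ^+ 2.
  rewrite -cardI [mu ^+ 2 * _]mulrC -sumr_cst mulr_sumr -sumrB -big_split.
  by apply: eq_bigr => i _ /=; ring.
rewrite suma; apply: le_trans (_ : n ^+ 4 + n ^+ 2 * (P - 2)
   - 2 * mu * (n ^+ 2 * (P - 2)) + mu ^+ 2 * (P - 1) ^+ 2 <= _).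
  by rewrite !lerD2r.
have muE : n ^+ 2 = mu * P by rewrite /mu divfK.
have muP : mu <= P.
  by rewrite /mu ler_pdivrMr // expr2 ler_pM.
have mu0 : 0 <= mu by rewrite /mu divr_ge0 ?exprn_ge0 // ltW.
have -> : n ^+ 4 = mu * P * (mu * P) by rewrite -muE; ring.
rewrite muE.
have : 0 <= mu * P by rewrite mulr_ge0 // ltW.
have : mu * mu <= mu * P by rewrite ler_wpM2l.
have : mu * P * mu <= mu * P * P by rewrite ler_wpM2l // mulr_ge0 // ltW.
have : mu * P * 1 <= mu * P * P by rewrite ler_wpM2l // mulr_ge0 // ltW.
nra.
Qed.

End SecondMoment.

(** With e = a - mu and f = b - mu, expand a b^2 = (mu + e)(mu + f)^2. The terms
    free of e f and f^2 give n^6 / P up to O(n^4), as e and f have sum -mu; the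
    quadratic ones are mu times a variance, so O(n^4); the cubic one is e f^2.
    The remaining sum of a b is at most a second moment, which is O(n^4) because
    P <= n^2. *)
Lemma third_moment (R : realType) (I : finType) (a b : I -> R) (P n : R) :
  1 <= P -> 0 <= n -> n <= P -> P <= n ^+ 2 ->
  (forall i, 0 <= a i) -> (forall i, 0 <= b i) ->
  #|I|%:R = (P - 1) ^+ 2 ->
  \sum_i a i = n ^+ 2 * (P - 2) -> \sum_i b i = n ^+ 2 * (P - 2) ->
  \sum_i a i ^+ 2 <= n ^+ 4 + n ^+ 2 * (P - 2) ->
  \sum_i b i ^+ 2 <= n ^+ 4 + n ^+ 2 * (P - 2) ->
  `|\sum_i a i * (b i * (b i - 1)) - n ^+ 6 / P|
    <= 18 * n ^+ 4 + (\sum_i `|a i - n ^+ 2 / P| ^+ 3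
                      + \sum_i `|b i - n ^+ 2 / P| ^+ 3).
Proof.
move=> P1 n0 nP Pn2 a0 b0 cI sa sb qa qb; set mu := n ^+ 2 / P.
have Pp : 0 < P := lt_le_trans ltr01 P1.
have Pn0 : P != 0 by rewrite gt_eqF.
have muE : n ^+ 2 = mu * P by rewrite /mu divfK.
have mu0 : 0 <= mu by rewrite /mu divr_ge0 ?exprn_ge0 // ltW.
have mu1 : 1 <= mu by rewrite /mu ler_pdivlMr // mul1r.
have Va := variance_le P1 n0 nP cI sa qa.
have Vb := variance_le P1 n0 nP cI sb qb.
have ea := sum_centred P1 cI sa; have eb := sum_centred P1 cI sb.
rewrite -/mu in Va Vb ea eb.
pose e i := a i - mu; pose f i := b i - mu.
have n4E : n ^+ 4 = mu * P * (mu * P) by rewrite -muE; ring.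
have E : \sum_i a i * (b i * (b i - 1)) = mu ^+ 3 * (P - 1) ^+ 2 - 3 * mu ^+ 3
   + mu * (\sum_i f i ^+ 2 + \sum_i 2 * (e i * f i)) + \sum_i e i * f i ^+ 2
   - \sum_i a i * b i.
  have -> : mu ^+ 3 * (P - 1) ^+ 2 - 3 * mu ^+ 3 = \sum_(i : I) mu ^+ 3
      + mu ^+ 2 * \sum_i (a i - mu) + 2 * mu ^+ 2 * \sum_i (b i - mu).
    by rewrite sumr_cst cI ea eb; ring.
  rewrite -!big_split /= !mulr_sumr -!big_split -sumrB /=.
  by apply: eq_bigr => i _; rewrite /e /f; ring.
have H1 : `|mu * (\sum_i f i ^+ 2 + \sum_i 2 * (e i * f i))| <= 12 * n ^+ 4.
  have -> : 12 * n ^+ 4 = mu * (12 * (n ^+ 2 * P)).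
    by rewrite n4E muE; ring.
  rewrite normrM (ger0_norm mu0) ler_wpM2l // (le_trans (ler_normD _ _)) //.
  rewrite ger0_norm; last by apply: sumr_ge0 => i _; exact: sqr_ge0.
  have : `|\sum_i 2 * (e i * f i)| <= \sum_i e i ^+ 2 + \sum_i f i ^+ 2.
    rewrite (le_trans (ler_norm_sum _ _ _)) // -big_split /=.
    apply: ler_sum => i _; rewrite ler_norml; apply/andP; split.
      by have := sqr_ge0 (e i + f i); nra.
    by have := sqr_ge0 (e i - f i); nra.
  rewrite /e /f in Va Vb *; lra.
have H2 : `|\sum_i e i * f i ^+ 2| <= \sum_i `|e i| ^+ 3 + \sum_i `|f i| ^+ 3.
  rewrite (le_trans (ler_norm_sum _ _ _)) // -big_split /=.
  apply: ler_sum => i _; rewrite normrM normrX.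
  have x0 := normr_ge0 (e i); have y0 := normr_ge0 (f i).
  move: `|e i| `|f i| x0 y0 => x y x0 y0.
  have x3 := exprn_ge0 3 x0; have y3 := exprn_ge0 3 y0.
  have [xy|/ltW yx] := leP x y.
    have : x * y ^+ 2 <= y * y ^+ 2 by rewrite ler_wpM2r ?exprn_ge0.
    by rewrite -exprS; lra.
  have : x * y ^+ 2 <= x * x ^+ 2 by rewrite ler_wpM2l // ler_pXn2r.
  by rewrite -exprS; lra.
have H3 : `|\sum_i a i * b i| <= 2 * n ^+ 4.
  rewrite ger0_norm; last by apply: sumr_ge0 => i _; apply: mulr_ge0.
  have : \sum_i 2 * (a i * b i) <= \sum_i a i ^+ 2 + \sum_i b i ^+ 2.
    rewrite -big_split /=; apply: ler_sum => i _.
    by have := sqr_ge0 (a i - b i); nra.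
  rewrite -mulr_sumr.
  have : n ^+ 2 * (P - 2) <= n ^+ 2 * n ^+ 2.
    by rewrite ler_wpM2l ?exprn_ge0 //; lra.
  rewrite -exprD; lra.
have H4 : `|mu ^+ 3 * (P - 1) ^+ 2 - 3 * mu ^+ 3 - n ^+ 6 / P| <= 4 * n ^+ 4.
  have -> : n ^+ 6 / P = mu ^+ 3 * P ^+ 2.
    by rewrite (exprM n 2 3) muE; field.
  have -> : n ^+ 4 = mu ^+ 2 * P ^+ 2 by rewrite n4E; ring.
  have -> : mu ^+ 3 * (P - 1) ^+ 2 - 3 * mu ^+ 3 - mu ^+ 3 * P ^+ 2
     = - (mu ^+ 2 * (mu * (2 * P + 2))) by ring.
  have muP : mu <= P by rewrite /mu ler_pdivrMr // expr2 ler_pM.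
  have q0 : 0 <= 2 * P + 2 by lra.
  rewrite normrN ger0_norm; last by rewrite mulr_ge0 ?exprn_ge0 // mulr_ge0.
  rewrite [leRHS]mulrCA ler_wpM2l ?exprn_ge0 //.
  have : mu * (2 * P + 2) <= P * (2 * P + 2) by rewrite ler_wpM2r //; lra.
  nra.
rewrite E.
set X := _ - 3 * mu ^+ 3 in H4 *; set Y := mu * _ in H1 *.
set Z := \sum_i e i * _ in H2 *; set W := \sum_i a i * b i in H3 *.
have -> : X + Y + Z - W - n ^+ 6 / P = (X - n ^+ 6 / P) + Y + Z - W by ring.
rewrite (le_trans (ler_normB _ _)) //.
have := ler_normD (X - n ^+ 6 / P + Y) Z.
have := ler_normD (X - n ^+ 6 / P) Y.
rewrite /e /f in H2; lra.
Qed.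

(** Each term 1 / (i + 1) is at most ln (i + 1) - ln i. *)
Lemma sum_inv_le_ln (R : realType) (K n : nat) : (0 < K)%N -> (K <= n)%N ->
  \sum_(K <= i < n) (i.+1%:R)^-1 <= ln (n%:R : R).
Proof.
move=> K0; elim: n => [|n IH] Kn; first by rewrite big_geq // ln0.
case: (ltngtP K n.+1) Kn => // [Kn|->] _; last first.
  by rewrite big_geq // ln_ge0 // ler1n.
rewrite big_nat_recr //=.
have nn : (0 < n)%N := leq_trans K0 Kn.
have n0 : 0 < n%:R :> R by rewrite ltr0n.
have n10 : 0 < n.+1%:R :> R by rewrite ltr0n.
have : ln (1 - (n.+1%:R)^-1) <= - (n.+1%:R)^-1 :> R.
  apply: le_ln1Dx; rewrite ltrN2 invf_lt1 // ltr1n //.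
have -> : 1 - (n.+1%:R)^-1 = n%:R / n.+1%:R :> R.
  by rewrite -natr1; field; rewrite natr1 gt_eqF.
rewrite ln_div ?posrE // => h; have := IH Kn; move: h.
move: (ln _) (ln _) (_^-1) (\sum_(_ <= _ < _) _) => x y z t; lra.
Qed.

(** The layer-cake decomposition of k^3 from level K on, with the increments
    (i + 1)^3 - i^3 bounded by 3 (i + 1)^2. *)
Lemma cube_le_layers K n k : (k <= n)%N ->
  ((K <= k) * k ^ 3 <= (K <= k) * K ^ 3 + \sum_(K <= i < n) (i < k) * (3 * i.+1 ^ 2))%N.
Proof.
move=> kn; case: (leqP K k) => [Kk|_]; last by rewrite mul0n.
rewrite /= !mul1n (big_cat_nat (n := k)) //=.
rewrite addnA; apply: (leq_trans _ (leq_addr _ _)).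
rewrite (eq_big_nat _ _ (F2 := fun i => 3 * i.+1 ^ 2)%N); last first.
  by move=> i /andP[_ ->]; rewrite mul1n.
elim: k Kk {kn} => [|k IH]; first by rewrite leqn0 => /eqP ->.
case: (ltngtP K k.+1) => // [Kk|->] _; last by rewrite leq_addr.
rewrite big_nat_recr //= addnA.
have := IH Kk; rewrite !expnS !expn0; lia.
Qed.

Lemma sum_nat_cond (I : finType) (Q : pred I) c :
  (\sum_i (Q i : nat) * c = #|[set i | Q i]| * c)%N.
Proof.
rewrite -big_distrl /= -sum1dep_card; congr (_ * _)%N.
by rewrite [RHS]big_mkcond; apply: eq_bigr => i _; case: (Q i).
Qed.

(** Each layer i + 1 > K has at most 54 * 1024 n^4 / (i + 1)^3 lines and weight
    3 (i + 1)^2, so the layers add up to a harmonic sum. *)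
Lemma tail_third_moment (R : realType) (p : nat) (G : {group {unit 'F_p}}) K :
  prime p -> (#|G| ^ 3 <= p ^ 2)%N -> (128 <= K)%N ->
  (128 * #|G| ^ 2 <= K * p)%N ->
  (\sum_l (K <= #|line_pts G l|) * #|line_pts G l| ^ 3)%:R
  <= (54 * 1024)%:R * #|G|%:R ^+ 4 * (1 + 3 * ln #|G|%:R) :> R.
Proof.
move=> pp; set n := #|G| => n3 K128 Kp.
have n0 : (0 < n)%N := cardG_gt0 G.
have lev tau : (K <= tau)%N ->
    (#|[set l | (tau <= #|line_pts G l|)%N]| * tau ^ 3 <= 54 * 1024 * n ^ 4)%N.
  move=> Kt; apply: level_set_bound => //; first exact: leq_trans Kt.
  by rewrite (leq_trans Kp) // leq_mul2r Kt orbT.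
move: lev; move: (54 * 1024)%N => c lev.
have step : (\sum_l (K <= #|line_pts G l|) * #|line_pts G l| ^ 3
    <= c * n ^ 4 + \sum_(K <= i < n)
         #|[set l | (i.+1 <= #|line_pts G l|)%N]| * (3 * i.+1 ^ 2))%N.
  apply: leq_trans (leq_sum _ (fun l _ => cube_le_layers K (line_pts_le G l))) _.
  rewrite big_split /= sum_nat_cond leq_add ?lev //.
  rewrite exchange_big /=; apply: leq_sum => i _.
  by rewrite sum_nat_cond.
apply: (@le_trans _ _ (c%:R * n%:R ^+ 4 +
  \sum_(K <= i < n) 3 * (c%:R * n%:R ^+ 4) * (i.+1%:R)^-1)).
  apply: le_trans (_ : _ <= (_ : nat)%:R) _; first by rewrite ler_nat; exact: step.
  rewrite natrD natrM natrX lerD2l natr_sum big_nat_cond [leRHS]big_nat_cond.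
  apply: ler_sum => i; rewrite andbT => /andP[Ki _].
  have i0 : 0 < i.+1%:R :> R by rewrite ltr0n.
  rewrite ler_pdivlMr //.
  have -> : 3 * (c%:R * n%:R ^+ 4) = (3 * (c * n ^ 4))%N%:R :> R.
    by rewrite natrM natrM natrX.
  rewrite -natrM ler_nat.
  have := lev i.+1 (leqW Ki).
  by move: (#|_|) => L; rewrite [(i.+1 ^ 3)%N]expnSr; lia.
rewrite -mulr_sumr.
have [Kn|nK] := leqP K n; last first.
  rewrite big_geq; last exact: ltnW.
  rewrite mulr0 addr0 ler_peMr ?mulr_ge0 ?exprn_ge0 //.
  by rewrite lerDl mulr_ge0 // ln_ge0 // ler1n.
have K0 : (0 < K)%N by lia.
have := sum_inv_le_ln R K0 Kn.
have : 0 <= c%:R * n%:R ^+ 4 :> R by rewrite mulr_ge0 ?exprn_ge0.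
move: (\sum_(_ <= _ < _) _) (ln _) (_ * _ ^+ 4) => s t x x0 st.
have : x * s <= x * t by rewrite ler_wpM2l.
lra.
Qed.

(** * Two estimates for T *)

Lemma card_group_lt p (G : {group {unit 'F_p}}) : prime p -> (#|G| < p)%N.
Proof.
move=> pp; apply: leq_ltn_trans (max_card _) _.
by rewrite card_unit_Fp // ltn_predL prime_gt0.
Qed.

(** Compare with the larger of a and b. The factor vanishing at 1 is kept on both
    sides: without it the sum over lines would be of order n^2 p, which exceeds
    n^4 when n^2 < p. *)
Lemma mixed_cube_le a b : (a * (b * b.-1) <= a ^ 2 * a.-1 + b ^ 2 * b.-1)%N.
Proof.
have [ab|/ltnW ba] := leqP a b.
  apply: leq_trans (leq_addl _ _).
  by rewrite mulnA -mulnn; apply: leq_mul => //; apply: leq_mul.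
apply: leq_trans (leq_addr _ _).
rewrite mulnA -mulnn; apply: leq_mul; first by apply: leq_mul.
by move: ba; lia.
Qed.

Section Asymptotics.
Variables (R : realType) (p : nat) (G : {group {unit 'F_p}}).
Hypothesis pp : prime p.
Let P : R := p%:R.
Let n : R := #|G|%:R.
Let mu : R := n ^+ 2 / P.
Local Notation N l := (#|line_pts G l|%:R : R).

Let P1 : 1 <= P. Proof. by rewrite ler1n prime_gt0. Qed.
Let P0 : 0 < P. Proof. exact: lt_le_trans ltr01 P1. Qed.
Let n1 : 1 <= n. Proof. by rewrite ler1n cardG_gt0. Qed.
Let n0 : 0 <= n. Proof. exact: le_trans ler01 n1. Qed.
Let nP : n <= P. Proof. by rewrite ler_nat ltnW // card_group_lt. Qed.
Let mu0 : 0 <= mu. Proof. by rewrite divr_ge0 ?exprn_ge0 // ltW. Qed.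

Lemma card_lines : #|{: {unit 'F_p} * {unit 'F_p}}|%:R = (P - 1) ^+ 2.
Proof.
rewrite card_prod card_unit_Fp // natrM expr2.
by rewrite -subn1 natrB // prime_gt0.
Qed.

Lemma sum_line_pts_real : \sum_l N l = n ^+ 2 * (P - 2).
Proof.
by rewrite -natr_sum sum_line_pts // natrM natrX natrB // prime_gt1.
Qed.

Lemma sum_sqr_line_pts_real : \sum_l N l ^+ 2 <= n ^+ 4 + n ^+ 2 * (P - 2).
Proof.
rewrite -sum_line_pts_real.
have -> : \sum_l N l ^+ 2
    = (\sum_l #|line_pts G l| * (#|line_pts G l|).-1)%:R + \sum_l N l.
  rewrite natr_sum -big_split /=; apply: eq_bigr => l _.
  by rewrite -natrX -natrD; congr (_%:R); case: #|_| => [|k]; lia.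
by rewrite lerD2r -natrX ler_nat sum_line_pairs.
Qed.

Lemma line_pts_variance : \sum_l (N l - mu) ^+ 2 <= 4 * (n ^+ 2 * P).
Proof.
exact: (variance_le P1 n0 nP card_lines sum_line_pts_real sum_sqr_line_pts_real).
Qed.

Lemma Tsubgroup_approx lambda :
  `|(Tsubgroup lambda G)%:R - \sum_l N l *
     (N (scale_line lambda l) * (N (scale_line lambda l) - 1))| <= 2 * n ^+ 4.
Proof.
have -> : \sum_l N l * (N (scale_line lambda l) * (N (scale_line lambda l) - 1))
    = (\sum_l #|triples G l lambda|)%:R.
  rewrite natr_sum; apply: eq_bigr => l _; rewrite card_triples !natrM.
  by case: #|line_pts G (scale_line _ _)| => [|k]; rewrite ?mul0r // -natr1 addrK.
have := sum_triples_le G lambda; have := Tset_le_sum_triples G lambda.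
rewrite Tsubgroup_card; move: (\sum_l _)%N #|Tset _ _| => s t.
rewrite -(ler_nat R) natrD (natrM _ 2) natrX -/n => h1.
rewrite -(ler_nat R) natrD natrX -/n => h2.
have := exprn_ge0 4 n0.
by rewrite ler_norml => h; apply/andP; split; lra.
Qed.

(** The condition p <= n^2 makes the second moment of N, of order n^2 p + n^4,
    at most of order n^4. *)
Lemma Tsubgroup_third_moment lambda : (p <= #|G| ^ 2)%N ->
  `|(Tsubgroup lambda G)%:R - n ^+ 6 / P|
   <= 20 * n ^+ 4 + 2 * \sum_l `|N l - mu| ^+ 3.
Proof.
rewrite -(ler_nat R) natrX -/P -/n => Pn2.
pose S := \sum_l N l * (N (scale_line lambda l) * (N (scale_line lambda l) - 1)).
have : `|S - n ^+ 6 / P| <= 18 * n ^+ 4 + (\sum_l `|N l - mu| ^+ 3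
    + \sum_l `|N (scale_line lambda l) - mu| ^+ 3).
  apply: third_moment => //; rewrite ?card_lines //.
  - exact: sum_line_pts_real.
  - by rewrite (sum_scale_line G lambda (fun k => k%:R)) sum_line_pts_real.
  - exact: sum_sqr_line_pts_real.
  - rewrite (sum_scale_line G lambda (fun k => k%:R ^+ 2)).
    exact: sum_sqr_line_pts_real.
rewrite (sum_scale_line G lambda (fun k => `|k%:R - mu| ^+ 3)).
have := Tsubgroup_approx lambda; rewrite -/S.
have := ler_normD ((Tsubgroup lambda G)%:R - S) (S - n ^+ 6 / P).
rewrite addrA subrK; move: (Tsubgroup _ _)%:R => t; lra.
Qed.

(** N is constant on orbits of size n^2, so n^2 (N - mu)^2 is at most the
    variance for each single line. *)
Lemma third_deviation_orbit :
  \sum_l `|N l - mu| ^+ 3 <= 8 * (P * Num.sqrt P * n ^+ 2).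
Proof.
have sP : Num.sqrt P ^+ 2 = P by rewrite sqr_sqrtr // ltW.
have bnd l : `|N l - mu| <= 2 * Num.sqrt P.
  have := @orbit_sum_le p G R (fun k => (k%:R - mu) ^+ 2) l (fun k => sqr_ge0 _).
  rewrite natrX -/n => h.
  have : n ^+ 2 * (N l - mu) ^+ 2 <= n ^+ 2 * (4 * P).
    by rewrite [leRHS]mulrCA; apply: le_trans h line_pts_variance.
  rewrite ler_pM2l ?exprn_gt0 // ?(lt_le_trans ltr01) //.
  rewrite -sqrtr_sqr => h2.
  rewrite -[2 * _]ger0_norm ?mulr_ge0 ?sqrtr_ge0 // -sqrtr_sqr ler_wsqrtr //.
  by rewrite exprMn sP; apply: le_trans h2 _; rewrite expr2; lra.
apply: (@le_trans _ _ (\sum_l 2 * Num.sqrt P * (N l - mu) ^+ 2)).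
  apply: ler_sum => l _; rewrite exprS -normrX [`|_ ^+ 2|]ger0_norm ?sqr_ge0 //.
  by rewrite ler_wpM2r ?sqr_ge0.
rewrite -mulr_sumr.
have s0 : 0 <= 2 * Num.sqrt P by rewrite mulr_ge0 ?sqrtr_ge0.
apply: le_trans (ler_wpM2l s0 line_pts_variance) _.
by rewrite le_eqVlt; apply/orP; left; apply/eqP; ring.
Qed.

Let c : R := (54 * 1024)%:R.

(** Cut at K of order mu + 1, up to a constant the least level that
    level_set_bound can treat:
    below K each deviation is at most K, above K it is at most N. *)
Lemma third_deviation_tail : (p <= #|G| ^ 2)%N -> (#|G| ^ 3 <= p ^ 2)%N ->
  \sum_l `|N l - mu| ^+ 3 <= 1024 * n ^+ 4 + c * n ^+ 4 * (1 + 3 * ln n).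
Proof.
move=> pn2 n3; pose K := (128 * (#|G| ^ 2 %/ p).+1)%N.
have p0 : (0 < p)%N := prime_gt0 pp.
have Kp : (128 * #|G| ^ 2 <= K * p)%N.
  by rewrite -mulnA leq_mul2l ltnW //= ltn_ceil.
have K128 : (128 <= K)%N by rewrite leq_pmulr.
have KP : K%:R * P <= 256 * n ^+ 2 :> R.
  rewrite -natrX -!natrM ler_nat -mulnA mulSn.
  by have := leq_trunc_div (#|G| ^ 2) p; lia.
have muK : mu <= K%:R.
  rewrite ler_pdivrMr // -natrX -natrM ler_nat (leq_trans _ Kp) //.
  by rewrite leq_pmull.
apply: (@le_trans _ _ (K%:R * (\sum_l (N l - mu) ^+ 2) +
   (\sum_l (K <= #|line_pts G l|) * #|line_pts G l| ^ 3)%:R)); last first.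
  apply: lerD; last exact: tail_third_moment.
  apply: (@le_trans _ _ (K%:R * (4 * (n ^+ 2 * P)))).
    by rewrite ler_wpM2l // line_pts_variance.
  have -> : K%:R * (4 * (n ^+ 2 * P)) = 4 * n ^+ 2 * (K%:R * P) by ring.
  apply: (@le_trans _ _ (4 * n ^+ 2 * (256 * n ^+ 2))).
    by rewrite ler_wpM2l // mulr_ge0 // exprn_ge0.
  by rewrite le_eqVlt; apply/orP; left; apply/eqP; ring.
rewrite mulr_sumr natr_sum -big_split /=; apply: ler_sum => l _.
have [KN|NK] := leqP K #|line_pts G l|.
  rewrite mul1n natrX; apply: (@le_trans _ _ (N l ^+ 3)).
    rewrite ler_pXn2r ?nnegrE // ger0_norm; first by rewrite gerBl.
    by rewrite subr_ge0 (le_trans muK) // ler_nat.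
  by rewrite lerDr mulr_ge0 ?sqr_ge0.
rewrite mul0n addr0 exprS -normrX [`|_ ^+ 2|]ger0_norm ?sqr_ge0 //.
rewrite ler_wpM2r ?sqr_ge0 // ler_norml; apply/andP; split.
  by rewrite lerBrDr (le_trans _ (ler0n _ _)) // addrC subr_le0.
rewrite lerBlDr (@le_trans _ _ K%:R) ?lerDl //.
by rewrite ler_nat ltnW.
Qed.

(** For n^2 < p the main term n^6 / p is itself at most n^4, so an upper bound for
    T is enough. *)
Lemma Tsubgroup_sparse lambda : (#|G| ^ 2 < p)%N ->
  `|(Tsubgroup lambda G)%:R - n ^+ 6 / P|
   <= 259 * n ^+ 4 + 2 * (c * n ^+ 4 * (1 + 3 * ln n)).
Proof.
move=> n2p; have gp := card_group_lt G pp.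
have n3 : (#|G| ^ 3 <= p ^ 2)%N.
  by rewrite expnS -mulnn leq_mul // ltnW.
have Kp : (128 * #|G| ^ 2 <= 128 * p)%N by rewrite leq_mul2l ltnW.
have := @tail_third_moment R p G 128 pp n3 (leqnn _) Kp; rewrite -/n -/c.
set TK := (X in X%:R <= _) => tail.
have split_le k : (k ^ 2 * k.-1 <= 128 * (k * k.-1) + (128 <= k) * k ^ 3)%N.
  case: (leqP 128 k) => k128; last by rewrite mul0n addn0 -mulnn -mulnA leq_mul // ltnW.
  rewrite mul1n; apply: leq_trans (leq_addl _ _).
  by rewrite [(k ^ 3)%N]expnSr leq_mul2l leq_pred orbT.
have cubes : (\sum_l #|line_pts G l| ^ 2 * (#|line_pts G l|).-1
    <= 128 * #|G| ^ 4 + TK)%N.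
  apply: leq_trans (leq_sum _ (fun l _ => split_le #|line_pts G l|)) _.
  rewrite big_split /= leq_add2r -big_distrr leq_mul2l /=.
  exact: sum_line_pairs.
have main : (\sum_l #|triples G l lambda| <= 2 * (128 * #|G| ^ 4 + TK))%N.
  apply: (@leq_trans (\sum_l (#|line_pts G l| ^ 2 * (#|line_pts G l|).-1
     + #|line_pts G (scale_line lambda l)| ^ 2
         * (#|line_pts G (scale_line lambda l)|).-1))%N).
    by apply: leq_sum => l _; rewrite card_triples; apply: mixed_cube_le.
  rewrite big_split /= (sum_scale_line G lambda (fun k => k ^ 2 * k.-1)%N).
  by rewrite addnn -mul2n leq_mul2l /=.
have T_le : (Tsubgroup lambda G <= 2 * (128 * #|G| ^ 4 + TK) + 2 * #|G| ^ 4)%N.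
  rewrite Tsubgroup_card; apply: leq_trans (Tset_le_sum_triples G lambda) _.
  by rewrite leq_add2r.
move: T_le; rewrite -(ler_nat R) natrD !(natrM _ 2) natrD (natrM _ 128).
rewrite !natrX -/n => T_le.
have X_le : n ^+ 6 / P <= n ^+ 4.
  rewrite ler_pdivrMr // -(natrX _ _ 6) -(natrX _ _ 4) -natrM ler_nat.
  by rewrite (expnD _ 4 2) leq_mul2l ltnW ?orbT.
have X0 : 0 <= n ^+ 6 / P by rewrite divr_ge0 ?exprn_ge0 // ltW.
have T0 : 0 <= (Tsubgroup lambda G)%:R :> R by [].
by rewrite ler_norml; apply/andP; split; lra.
Qed.

Lemma Tsubgroup_large lambda : (p <= #|G| ^ 2)%N ->
  `|(Tsubgroup lambda G)%:R - n ^+ 6 / P|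
    <= 20 * n ^+ 4 + 16 * (P * Num.sqrt P * n ^+ 2).
Proof.
move=> /(Tsubgroup_third_moment lambda) h; apply: le_trans h _.
have := third_deviation_orbit; lra.
Qed.

Lemma Tsubgroup_small lambda : (#|G| ^ 3 <= p ^ 2)%N ->
  `|(Tsubgroup lambda G)%:R - n ^+ 6 / P|
    <= (2068 + 6 * c) * (n ^+ 4 * (1 + ln n)).
Proof.
move=> n3.
have x0 : 0 <= n ^+ 4 by rewrite exprn_ge0.
have l0 : 0 <= n ^+ 4 * ln n by rewrite mulr_ge0 // ln_ge0.
have cx0 : 0 <= c * n ^+ 4 by rewrite mulr_ge0.
have cl0 : 0 <= c * n ^+ 4 * ln n by rewrite mulr_ge0 // ln_ge0.
have [pn2|n2p] := leqP p (#|G| ^ 2)%N.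
  apply: le_trans (Tsubgroup_third_moment lambda pn2) _.
  have := third_deviation_tail pn2 n3; nra.
apply: le_trans (Tsubgroup_sparse lambda n2p) _; nra.
Qed.

End Asymptotics.

Lemma Tsubgroup_small_const (R : realType) :
  exists2 c : R, 2068 <= c &
  forall (p : nat) (G : {group {unit 'F_p}}) (lambda : {unit 'F_p}),
    prime p -> (#|G| ^ 3 <= p ^ 2)%N ->
    `|(Tsubgroup lambda G)%:R - #|G|%:R ^+ 6 / p%:R|
      <= c * (#|G|%:R ^+ 4 * (1 + ln #|G|%:R)).
Proof.
exists (2068 + 6 * (54 * 1024)%:R) => [|p G lambda pp n3].
  have := ler0n R (54 * 1024); move: (54 * 1024)%:R => k k0; lra.
exact: Tsubgroup_small.
Qed.

(** * The three ranges *)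

Lemma ln2_ge_half (R : realType) : 2^-1 <= ln 2 :> R.
Proof.
have : ln (1 + - 2^-1) <= - 2^-1 :> R by apply: le_ln1Dx; lra.
have -> : 1 + - 2^-1 = 2^-1 :> R by field.
by rewrite lnV ?posrE // lerN2.
Qed.

Lemma powR_sqrt (R : realType) (x : R) : 0 <= x -> x `^ (1 / 2) = Num.sqrt x.
Proof. by move=> x0; rewrite div1r powR12_sqrt. Qed.

Lemma powR_nat_half (R : realType) (x : R) k : 0 < x ->
  x `^ (k%:R + 1 / 2) = x ^+ k * Num.sqrt x.
Proof.
move=> x0; rewrite powRD ?gt_eqF ?implybT //.
by rewrite powR_mulrn ?powR_sqrt // ltW.
Qed.

(** The hypothesis raised to the power 3/2. *)
Lemma le_mul_sqrt (R : realType) (P N : R) :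
  1 <= P -> P `^ (2 / 3) <= N -> P <= N * Num.sqrt N.
Proof.
move=> P1 h; have P0 : 0 < P := lt_le_trans ltr01 P1.
have N0 : 0 < N := lt_le_trans (powR_gt0 _ P0) h.
have -> : N * Num.sqrt N = N `^ (3 / 2).
  by rewrite (_ : 3 / 2 = 1%:R + 1 / 2) ?powR_nat_half //; field.
have PE : (P `^ (2 / 3)) `^ (3 / 2) = P.
  by rewrite -powRrM (_ : 2 / 3 * (3 / 2) = 1) ?powRr1 ?ltW //; field.
have r0 : 0 <= 3 / 2 :> R by lra.
have := ge0_ler_powR r0 _ _ h; rewrite PE; apply; rewrite nnegrE ?powR_ge0 //.
exact: ltW.
Qed.

Lemma large_case (R : realType) (P N : R) :
  1 <= P -> 1 <= N -> N <= P -> P `^ (2 / 3) <= N ->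
  20 * N ^+ 4 + 16 * (P * Num.sqrt P * N ^+ 2)
    <= 36 * (P `^ (1 / 2) * N `^ (7 / 2)).
Proof.
move=> P1 N1 NP h; have PN := le_mul_sqrt P1 h.
have P0 : 0 < P := lt_le_trans ltr01 P1.
have N0 : 0 < N := lt_le_trans ltr01 N1.
rewrite powR_sqrt ?(ltW P0) // (_ : 7 / 2 = 3%:R + 1 / 2); last by field.
rewrite powR_nat_half //.
have sN := sqr_sqrtr (ltW N0).
have sNP : Num.sqrt N <= Num.sqrt P by rewrite ler_wsqrtr.
have s0 := sqrtr_ge0 N.
have t0 := sqrtr_ge0 P.
have A1 : N ^+ 4 <= Num.sqrt P * (N ^+ 3 * Num.sqrt N).
  have -> : N ^+ 4 = Num.sqrt N * (N ^+ 3 * Num.sqrt N).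
    by transitivity (N ^+ 3 * Num.sqrt N ^+ 2); [rewrite sN -exprSr|ring].
  by rewrite ler_wpM2r // mulr_ge0 // exprn_ge0 // ltW.
have A2 : P * Num.sqrt P * N ^+ 2 <= Num.sqrt P * (N ^+ 3 * Num.sqrt N).
  have -> : P * Num.sqrt P * N ^+ 2 = Num.sqrt P * (N ^+ 2 * P) by ring.
  have -> : N ^+ 3 * Num.sqrt N = N ^+ 2 * (N * Num.sqrt N) by ring.
  by rewrite ler_wpM2l // ler_wpM2l // exprn_ge0 // ltW.
lra.
Qed.

(** Put q = P^(1/12). The hypotheses read q^8 <= N < 12 q^6 ln q <= 12 q^7, so
    q < 12, and P sqrt P = q^18 = q^2 (q^8)^2 <= 144 N^2. *)
Lemma overlap_case (R : realType) (P N : R) :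
  1 <= P -> P `^ (2 / 3) <= N -> N < P `^ (1 / 2) * ln P ->
  P * Num.sqrt P <= 144 * N ^+ 2.
Proof.
move=> P1; have P0 : 0 < P := lt_le_trans ltr01 P1.
pose q := P `^ (12%:R)^-1; have q0 : 0 < q by rewrite powR_gt0.
have qk k : P `^ (12%:R^-1 * k%:R) = q ^+ k.
  by rewrite powRrM powR_mulrn // powR_ge0.
have Pq : P = q ^+ 12.
  by rewrite -qk mulVf ?pnatr_eq0 // powRr1 // ltW.
have sPq : Num.sqrt P = q ^+ 6.
  by rewrite {1}Pq (exprM q 6 2) sqrtr_sqr ger0_norm // exprn_ge0 // ltW.
rewrite powR_sqrt ?(ltW P0) // (_ : 2 / 3 = 12%:R^-1 * 8%:R); last by field.
rewrite qk sPq => qN Nq.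
have lnP : ln P <= 12 * q.
  rewrite {1}Pq lnXn // -(mulr_natl (ln q)) ler_pM2l //.
  exact/ltW/ln_sublinear.
have q12 : q < 12.
  rewrite -(ltr_pM2l (exprn_gt0 7 q0)) -exprSr.
  apply: le_lt_trans qN _; apply: lt_le_trans Nq _.
  have -> : q ^+ 7 * 12 = q ^+ 6 * (12 * q) by ring.
  by rewrite ler_wpM2l // exprn_ge0 // ltW.
have -> : P * q ^+ 6 = q ^+ 2 * (q ^+ 8) ^+ 2 by rewrite {1}Pq; ring.
apply: ler_pM; rewrite ?exprn_ge0 ?(ltW q0) //.
  rewrite (_ : 144 = 12 ^+ 2); last by ring.
  by rewrite ler_pXn2r ?nnegrE ?(ltW q0) // ltW.
have q80 : 0 <= q ^+ 8 by rewrite exprn_ge0 // ltW.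
by rewrite ler_pXn2r ?nnegrE // (le_trans q80).
Qed.

Theorem theorem1p2 (R : realType) :
  exists2 C : R, 0 < C &
  forall (p : nat) (G : {group {unit 'F_p}}) (lambda : {unit 'F_p}),
  prime p ->
  let P : R := p%:R in
  let N : R := #|G|%:R in
  let Delta : R := `|(Tsubgroup lambda G)%:R - N ^+ 6 / P| in
  [/\ P `^ (2 / 3) <= N ->
        Delta <= C * (P `^ (1 / 2) * N `^ (7 / 2)),
      N < P `^ (2 / 3) -> P `^ (1 / 2) * ln P <= N ->
        Delta <= C * (N ^+ 5 * P `^ (- (1 / 2)))
    & N < P `^ (1 / 2) * ln P -> (1 < #|G|)%N ->
        Delta <= C * (N ^+ 4 * ln N)].
Proof.
have [c c1 bound] := Tsubgroup_small_const R.
have c0 : 0 <= c by lra.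
exists (3 * c) => [|p G lambda pp P N Delta].
  by rewrite mulr_gt0 //; lra.
have P2 : 2 <= P by rewrite ler_nat prime_gt1.
have P1 : 1 <= P by apply: le_trans P2; rewrite ler1n.
have P0 : 0 < P := lt_le_trans ltr01 P1.
have N1 : 1 <= N by rewrite ler1n cardG_gt0.
have N0 : 0 < N := lt_le_trans ltr01 N1.
have NP : N <= P by rewrite ler_nat ltnW // card_group_lt.
have lnNP : ln N <= ln P by rewrite ler_ln ?posrE.
have lnP : 1 <= 2 * ln P.
  have : ln 2 <= ln P by rewrite ler_ln ?posrE.
  by have := ln2_ge_half R; lra.
have lnN0 : 0 <= ln N by rewrite ln_ge0.
have large : P `^ (2 / 3) <= N ->
    Delta <= 20 * N ^+ 4 + 16 * (P * Num.sqrt P * N ^+ 2).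
  move=> /(le_mul_sqrt P1) PN; apply: Tsubgroup_large => //.
  have sN : Num.sqrt N <= N.
    rewrite -[leRHS](ger0_norm (ltW N0)) -sqrtr_sqr ler_wsqrtr //.
    by rewrite expr2 ler_peMr // ltW.
  rewrite -(ler_nat R) natrX -/P -/N; apply: le_trans PN _.
  by rewrite expr2 ler_wpM2l // ltW.
have small : N < P `^ (2 / 3) -> Delta <= c * (N ^+ 4 * (1 + ln N)).
  move=> h; apply: bound => //.
  rewrite -(ler_nat R) !natrX -/P -/N.
  have -> : P ^+ 2 = (P `^ (2 / 3)) ^+ 3.
    rewrite -[_ ^+ 3]powR_mulrn ?powR_ge0 // -powRrM divfK ?pnatr_eq0 //.
    by rewrite powR_mulrn // ltW.
  by rewrite ler_pXn2r ?nnegrE ?powR_ge0 ?(ltW N0) ?ltW.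
have N40 : 0 <= N ^+ 4 by rewrite exprn_ge0 // ltW.
split=> [h|h1 h2|h n1].
- apply: le_trans (large h) _; apply: le_trans (large_case P1 N1 NP h) _.
  by rewrite ler_wpM2r ?mulr_ge0 ?powR_ge0 //; lra.
- apply: le_trans (small h1) _; rewrite powRN powR_sqrt ?(ltW P0) //.
  rewrite powR_sqrt ?(ltW P0) // in h2.
  have s0 : 0 < Num.sqrt P by rewrite sqrtr_gt0.
  have lnPN : ln P <= N / Num.sqrt P by rewrite ler_pdivlMr // mulrC.
  have -> : 3 * c * (N ^+ 5 / Num.sqrt P) = c * (N ^+ 4 * (3 * (N / Num.sqrt P))).
    by ring.
  by rewrite !ler_wpM2l //; lra.
have lnN : 1 <= 2 * ln N.
  have : ln 2 <= ln N by rewrite ler_ln ?posrE // (ler_nat R 2).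
  by have := ln2_ge_half R; lra.
have [big|/small] := leP (P `^ (2 / 3)) N; last first.
  move=> h3; apply: le_trans h3 _.
  have -> : 3 * c * (N ^+ 4 * ln N) = c * (N ^+ 4 * (3 * ln N)) by ring.
  by rewrite !ler_wpM2l //; lra.
apply: le_trans (large big) _.
have : P * Num.sqrt P * N ^+ 2 <= 144 * N ^+ 4.
  have -> : 144 * N ^+ 4 = 144 * N ^+ 2 * N ^+ 2 by ring.
  by rewrite ler_wpM2r ?exprn_ge0 ?(ltW N0) // overlap_case.
have : N ^+ 4 <= N ^+ 4 * (2 * ln N) by rewrite ler_peMr.
have : 0 <= N ^+ 4 * ln N by rewrite mulr_ge0.
nra.
Qed.
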